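(* Let $T>0$. If a state $W^0\in\widetilde H^0$ is null-controllable in the time $T$ for the control system $W_t=W_{xx}-2u\delta'$, $x\in\mathbb R$, $t\in(0,T)$, $W(\cdot,0)=W^0$ (that is, $0\in\mathcal R_T(W^0)$), then $W^0=0$.
   Context: For $m=0,1,2$, $H^m$ is the Sobolev space of $\varphi\in L^2(\mathbb R)$ with $\varphi^{(k)}\in L^2(\mathbb R)$, $k\le m$; $H^{-m}=(H^m)^*$; $\widetilde H^{n}$ is the closed subspace of odd distributions in $H^{n}$, $n=-2,\dots,2$. In particular $\widetilde H^0$ is the space of odd functions in $L^2(\mathbb R)$ with the $L^2(\mathbb R)$ norm. States and controls are over one fixed scalar field. Control system: for $T>0$, an initial state $W^0\in\widetilde H^0$ and a control $u\in L^\infty(0,T)$ consider $$W_t=W_{xx}-2u(t)\delta',\quad x\in\mathbb R,\ t\in(0,T),\qquad W(\cdot,0)=W^0,$$ where $\delta$ is the Dirac distribution in $x$ and $\left(\frac{d}{dt}\right)^m W:[0,T]\to\widetilde H^{-2m}$, $m=0,1$. Its unique solution is given, for $t\in(0,T]$, by $$W(x,t)=\frac{e^{-\frac{x^2}{4t}}}{\sqrt{4\pi t}}*W^0(x)+\sqrt{\tfrac2\pi}\,x\int_0^t e^{-\frac{x^2}{4\xi}}\frac{u(t-\xi)}{(2\xi)^{3/2}}\,d\xi,$$ where $*$ is convolution in $x$. A state $W^T\in\widetilde H^0$ is reachable from $W^0$ in time $T$ if there is $u\in L^\infty(0,T)$ such that there exists a unique solution $W$ of the system, and $W(\cdot,T)=W^T$.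 $\mathcal R_T(W^0)$ is the set of all states in $\widetilde H^0$ reachable from $W^0$ in time $T$. A state $W^0\in\widetilde H^0$ is null-controllable in time $T$ if $0\in\mathcal R_T(W^0)$, i.e. there is $u\in L^\infty(0,T)$ such that there exists a unique solution $W$ of the system, and $W(\cdot,T)=0$. *)

(* Defs.v *)
From mathcomp Require Import all_boot all_order all_algebra.
From mathcomp Require Import all_classical all_reals all_analysis.
From mathcomp Require Import complex.

Set Implicit Arguments.
Unset Strict Implicit.
Unset Printing Implicit Defensive.
Import Order.TTheory GRing.Theory Num.Theory.
Import numFieldNormedType.Exports.

Local Open Scope classical_set_scope.
Local Open Scope ring_scope.
Local Open Scope complex_scope.

(* The scalar field is the real or the complex numbers.  All functions below
   are R[i]-valued; over [RealScalars] they are required to take values with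
   zero imaginary part. *)
Inductive scalar_field := RealScalars | ComplexScalars.

Definition in_scalars (R : realType) (K : scalar_field) (z : R[i]) : Prop :=
  if K is RealScalars then complex.Im z = 0 else True.

Section complex_valued_functions.
Context {R : realType}.
Notation mu := (@lebesgue_measure R).
Implicit Types (f g : R -> R[i]) (D : set R).

Definition cmeasurable D f : Prop :=
  measurable_fun D (fun x => complex.Re (f x)) /\
  measurable_fun D (fun x => complex.Im (f x)).

Definition cintegrable D f : Prop :=
  mu.-integrable D (fun x => (complex.Re (f x))%:E) /\
  mu.-integrable D (fun x => (complex.Im (f x))%:E).

Definition cintegral D f : R[i] :=
  (\int[mu]_(x in D) complex.Re (f x)) +i*
  (\int[mu]_(x in D) complex.Im (f x)).

Definition ccontinuous f : Prop :=
  continuous (fun x => complex.Re (f x)) /\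
  continuous (fun x => complex.Im (f x)).

Definition eq_ae f g : Prop := {ae mu, forall x, f x = g x}.

Definition odd_ae f : Prop := {ae mu, forall x, f (- x) = - f x}.

Definition cLnorm (p : \bar R) D f : \bar R :=
  'N[mu]_p [EFin \o ((fun x => Normc.normc (f x)) \_ D)].

Definition in_Lp (K : scalar_field) (p : \bar R) D f : Prop :=
  [/\ forall x, D x -> in_scalars K (f x),
      cmeasurable D f &
      (cLnorm p D f < +oo)%E].

Definition L2 K f : Prop := in_Lp K 2%:E setT f.

Definition Linfty K (T : R) f : Prop := in_Lp K +oo%E `]0, T[ f.

End complex_valued_functions.

Section sobolev.
Context {R : realType}.
Implicit Types (K : scalar_field) (f g phi : R -> R[i]) (psi : R -> R).

Definition test_function psi : Prop :=
  (forall n x, derivable (derive1n n psi) x 1) /\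
  (exists M : R, forall x, M < `|x| -> psi x = 0).

(* Real test functions suffice: both sides are linear in psi. *)
Definition weak_derivative (k : nat) f g : Prop :=
  forall psi, test_function psi ->
    cintegral setT (fun x => f x * (derive1n k psi x)%:C) =
    (- 1) ^+ k * cintegral setT (fun x => g x * (psi x)%:C).

Definition sobolev K (m : nat) phi : Prop :=
  L2 K phi /\
  forall k, (k <= m)%N -> exists2 g, L2 K g & weak_derivative k phi g.

Definition sobolev_norm (m : nat) (d : nat -> R -> R[i]) : R :=
  Num.sqrt (\sum_(k < m.+1) fine (cLnorm 2%:E setT (d k)) ^+ 2).

(* [functional] is the carrier of the spaces H^{-m} = (H^m)^*; only the values
   on H^m matter.  The bound makes the values of L on H^m independent of the
   representatives modulo almost everywhere equality. *)
Definition functional := (R -> R[i]) -> R[i].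
Implicit Types L : functional.

Definition dual_sobolev K (m : nat) L : Prop :=
  [/\ forall phi, sobolev K m phi -> in_scalars K (L phi),
      forall (a b : R[i]) phi1 phi2, in_scalars K a -> in_scalars K b ->
        sobolev K m phi1 -> sobolev K m phi2 ->
        L (fun x => a * phi1 x + b * phi2 x) = a * L phi1 + b * L phi2 &
      exists C : R, forall phi (d : nat -> R -> R[i]),
        sobolev K m phi ->
        (forall k, (k <= m)%N -> L2 K (d k) /\ weak_derivative k phi (d k)) ->
        Normc.normc (L phi) <= C * sobolev_norm m d].

Definition odd_functional K (m : nat) L : Prop :=
  forall phi, sobolev K m phi -> L (fun x => phi (- x)) = - L phi.

Definition odd_L2 K f : Prop := L2 K f /\ odd_ae f.

Definition odd_dual_sobolev K (m : nat) L : Prop :=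
  dual_sobolev K m L /\ odd_functional K m L.

(* The pairing of distributions with functions is bilinear, also over the
   complex numbers: there is no conjugation. *)
Definition functional_of f : functional :=
  fun phi => cintegral setT (fun x => f x * phi x).

(* L' in H^{-(m+1)} is the distributional derivative of L in H^{-m}. *)
Definition distr_derivative K (m : nat) L L' : Prop :=
  [/\ dual_sobolev K m L, dual_sobolev K m.+1 L' &
      forall phi phi', sobolev K m.+1 phi ->
        L2 K phi' -> weak_derivative 1 phi phi' -> L' phi = - L phi'].

Definition second_derivative K f L : Prop :=
  exists2 L1, distr_derivative K 0 (functional_of f) L1 &
              distr_derivative K 1 L1 L.

(* Every class in H^1 has a unique continuous representative, so this
   determines L on H^1. *)
Definition dirac_distribution K L : Prop :=
  dual_sobolev K 1 L /\
  forall phi, sobolev K 1 phi -> ccontinuous phi -> L phi = phi 0.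

Definition dirac_derivative K L : Prop :=
  exists2 L0, dirac_distribution K L0 & distr_derivative K 1 L0 L.

End sobolev.

Section control_system.
Context {R : realType}.
Notation mu := (@lebesgue_measure R).
Implicit Types (K : scalar_field) (T : R) (WT u : R -> R[i]).

(* F : [0, T] -> H^{-m} is absolutely continuous with derivative G, in the
   integrated form F(t) = F(0) + int_0^t G(s) ds of an identity in H^{-m}. *)
Definition time_derivative K (m : nat) T (F G : R -> @functional R) : Prop :=
  forall phi, sobolev K m phi ->
    cintegrable `[0, T] (fun s => G s phi) /\
    forall t : R, 0 <= t <= T ->
      F t phi = F 0 phi + cintegral `[0, t] (fun s => G s phi).

(* W t is the state W(., t).  As u is only essentially bounded, the equation
   W_t = W_xx - 2 u delta' holds in H^{-2} for almost every t. *)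
Definition solution K T (W0 : R -> R[i]) u (W : R -> R -> R[i]) : Prop :=
  [/\ forall t : R, 0 <= t <= T -> odd_L2 K (W t),
      eq_ae (W 0) W0 &
      exists dW : R -> @functional R,
        [/\ forall t : R, 0 <= t <= T -> odd_dual_sobolev K 2 (dW t),
            time_derivative K 2 T (fun t => functional_of (W t)) dW &
            {ae mu, forall t : R, 0 < t < T ->
              exists Wxx delta',
                [/\ second_derivative K (W t) Wxx,
                    dirac_derivative K delta' &
                    forall phi, sobolev K 2 phi ->
                      dW t phi = Wxx phi - 2%:R * u t * delta' phi]}]].

Definition unique_solution K T (W0 : R -> R[i]) u (W : R -> R -> R[i]) : Prop :=
  solution K T W0 u W /\
  forall V, solution K T W0 u V ->
    forall t : R, 0 <= t <= T -> eq_ae (V t) (W t).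

Definition reachable_set K T (W0 : R -> R[i]) : set (R -> R[i]) :=
  [set WT | odd_L2 K WT /\
    exists2 u, Linfty K T u &
      exists2 W, unique_solution K T W0 u W & eq_ae (W T) WT].

Definition null_controllable K T (W0 : R -> R[i]) : Prop :=
  reachable_set K T W0 (cst 0).

End control_system.

(* Main.v *)
Require Import Defs.
From mathcomp Require Import all_boot all_order all_algebra.
From mathcomp Require Import all_classical all_reals all_analysis.
From mathcomp Require Import complex.
From mathcomp Require Import measurable_realfun ess_sup_inf.
From mathcomp Require Import ring lra.
Set Implicit Arguments.
Unset Strict Implicit.
Unset Printing Implicit Defensive.
Import Order.TTheory GRing.Theory Num.Theory.
Import numFieldNormedType.Exports.
Local Open Scope classical_set_scope.
Local Open Scope ring_scope.
Local Open Scope complex_scope.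

(* Pairing the solution with a solution phi of the backward heat equation gives
   <W(T), phi(T)> - <W0, phi(0)> = 2 int_0^T u(t) phi_x(0, t) dt.  For phi the
   imaginary part of the heat kernel of time tau - t, tau > T, centered at the
   imaginary point 2 i sqrt(n), and W(T) = 0, this bounds the exponential moments
   int_0^T u(t) (tau - t)^(-3/2) e^(n (1/(tau - t) - 1/tau)) dt uniformly in n.
   By Mikusinski's argument, based on Phragmen's kernel 1 - exp(-e^(n a)), a
   function with bounded exponential moments vanishes where the exponent is
   positive; hence u = 0.  Then real heat kernels give int W0(x) e^(-c (x-y)^2) dx
   = 0 for small c, hence for all c > 0 by analyticity, and the same kernel shows
   that all integrals of W0 over intervals vanish.

   Solutions are only required to be weakly absolutely continuous in time, so the
   uniform bounds behind the duality identity come from a gliding hump argument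
   on a bounded subset of H^2. *)

(** * Integrals, the exponential series and Phragmen's kernel *)

(** The imaginary centre is what separates the two ends of the duality identity. On the real line
    the kernel centred at i sigma, sigma^2 = 4n, is at time t at most of size e^(n/(tau - t)), hence
    of size e^(n/tau) at time 0. At x = 0 its imaginary part vanishes, but its slope there is a
    positive multiple of sigma e^(n/(tau - t)), free of oscillation. For t > 0 the control is thus
    seen with an exponentially larger weight than the initial state, and the quotient of the weights
    gives the bounded moments. Taking tau > T keeps the kernels smooth and rapidly decreasing on all
    of [0, T]. The obstacle is the product rule for <W(t), phi(t)>: each pairing with a fixed
    function is absolutely continuous, but its derivative exists only off a null set depending on
    that function. Instead, the difference of the two sides of the identity is shown to have
    increments O((t - s)^2). The constants need bounds uniform in time and in the test function
    together, while the hypotheses bound one test function at a time. The weight 1/(1 + x^2) is used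
    throughout because it is square integrable, so it pairs with L^2 states, and it dominates the
    Gaussian kernels. *)

Section expR_series.
Context {R : realType}.

Lemma is_cvg_expR_series (x : R) : \sum_(k < n) x ^+ k / k`!%:R @[n --> \oo] --> expR x.
Proof.
have := @is_cvg_series_exp_coeff R x; rewrite /expR => h.
have -> : (fun n : nat => \sum_(k < n) x ^+ k / k`!%:R) = series (exp_coeff x).
  by apply/funext => n; rewrite /series/= big_mkord.
exact: h.
Qed.

Lemma norm_expR_series (x : R) n : `|\sum_(k < n) x ^+ k / k`!%:R| <= expR `|x|.
Proof.
apply: le_trans (ler_norm_sum _ _ _) _.
apply: (@le_trans _ _ (\sum_(k < n) `|x| ^+ k / k`!%:R)).
  by apply: ler_sum => k _; rewrite normrM normrX (ger0_norm (x := (_)^-1))// invr_ge0.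
have := @is_cvg_expR_series `|x| => /cvg_lim <-//.
apply: (nondecreasing_cvgn_le (u_ := fun n => \sum_(k < n) `|x| ^+ k / k`!%:R)).
  move=> m p mp; rewrite -!(big_mkord xpredT (fun k => `|x| ^+ k / k`!%:R)).
  rewrite [leRHS](@big_cat_nat _ _ _ m)//= lerDl sumr_ge0//.
by apply/cvg_ex; eexists; exact: is_cvg_expR_series.
Qed.

Lemma exprn_div_fact_le (x : R) n : 0 <= x -> x ^+ n / n`!%:R <= expR x.
Proof.
move=> x0; have := norm_expR_series x n.+1; rewrite big_ord_recr/= (ger0_norm x0).
apply: le_trans; rewrite ger0_norm ?addr_ge0 ?lerDr ?sumr_ge0//.
- by move=> i _; rewrite divr_ge0// exprn_ge0.
- by move=> i _; rewrite divr_ge0// exprn_ge0.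
- by rewrite divr_ge0// exprn_ge0.
Qed.

Lemma is_cvg_expR_series1 (x : R) :
  \sum_(k < n) x ^+ k.+1 / k.+1`!%:R @[n --> \oo] --> expR x - 1.
Proof.
have := @is_cvg_expR_series x; rewrite -cvg_shiftS => h.
have -> : (fun n : nat => \sum_(k < n) x ^+ k.+1 / k.+1`!%:R) =
    (fun n : nat => \sum_(k < n.+1) x ^+ k / k`!%:R - 1).
  by apply/funext => n; rewrite big_ord_recl/= fact0 divr1 addrC addKr.
by apply: cvgB => //; exact: cvg_cst.
Qed.

Lemma norm_expR_series1 (x : R) n :
  `|\sum_(k < n) x ^+ k.+1 / k.+1`!%:R| <= `|x| * expR `|x|.
Proof.
apply: le_trans (ler_norm_sum _ _ _) _.
apply: (@le_trans _ _ (`|x| * \sum_(k < n) `|x| ^+ k / k`!%:R)); last first.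
  rewrite ler_wpM2l//; apply: le_trans (ler_norm _) _.
  by have := norm_expR_series `|x| n; rewrite normr_id.
rewrite mulr_sumr; apply: ler_sum => k _.
rewrite normrM normrX (ger0_norm (x := (_)^-1))// exprS -mulrA ler_wpM2l//.
by rewrite ler_wpM2l// lef_pV2 ?posrE ?ltr0n ?fact_gt0// ler_nat factS leq_pmull.
Qed.

End expR_series.

Section integration.
Context d {T : measurableType d} {R : realType}.
Variable mu : {measure set T -> \bar R}.
Implicit Types (f g h k y : T -> R) (D : set T).

Lemma measurable_intR D f : mu.-integrable D (EFin \o f) -> measurable_fun D f.
Proof. by move=> /integrableP[/measurable_EFinP]. Qed.

Lemma le_integrableR D f k : measurable D -> measurable_fun D f ->
  (forall x, D x -> `|f x| <= k x) -> mu.-integrable D (EFin \o k) ->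
  mu.-integrable D (EFin \o f).
Proof.
move=> mD mf fk; apply: le_integrable => //; first exact/measurable_EFinP.
by move=> x Dx; rewrite lee_fin (le_trans (fk x Dx))// ler_norm.
Qed.

Lemma integrableDR D f g : measurable D -> mu.-integrable D (EFin \o f) ->
  mu.-integrable D (EFin \o g) -> mu.-integrable D (EFin \o (fun x => f x + g x)).
Proof. by move=> mD fi gi; by have := integrableD mD fi gi. Qed.

Lemma integrableBR D f g : measurable D -> mu.-integrable D (EFin \o f) ->
  mu.-integrable D (EFin \o g) -> mu.-integrable D (EFin \o (fun x => f x - g x)).
Proof. by move=> mD fi gi; by have := integrableB mD fi gi. Qed.

Lemma integrableZR D c f : measurable D -> mu.-integrable D (EFin \o f) ->
  mu.-integrable D (EFin \o (fun x => c * f x)).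
Proof. by move=> mD fi; by have := integrableZl mD c fi. Qed.

Lemma integrable_patch D f : measurable D -> mu.-integrable D (EFin \o f) ->
  mu.-integrable setT (EFin \o (f \_ D)).
Proof. by move=> mD fi; rewrite -restrict_EFin; apply/(integrable_mkcond _ _).1. Qed.

Lemma le_norm_Rintegral D f k : measurable D -> measurable_fun D f ->
  mu.-integrable D (EFin \o k) -> (forall x, D x -> `|f x| <= k x) ->
  `|\int[mu]_(x in D) f x| <= \int[mu]_(x in D) k x.
Proof.
move=> mD mf ik fk; have fi := le_integrableR mD mf fk ik.
apply: le_trans (le_normr_Rintegral mD fi) _.
by apply: le_Rintegral => //; exact: integrable_norm.
Qed.

Lemma ae_eq_Rintegral D f g : measurable D -> measurable_fun D f ->
  measurable_fun D g -> {ae mu, forall x, D x -> f x = g x} ->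
  \int[mu]_(x in D) f x = \int[mu]_(x in D) g x.
Proof.
move=> mD mf mg fg; congr fine; apply: ae_eq_integral => //.
- exact/measurable_EFinP.
- exact/measurable_EFinP.
- by apply: filterS fg => x /= fgx Dx; rewrite fgx.
Qed.

Lemma dominated_convergenceR D (f_ : nat -> T -> R) f g : measurable D ->
  (forall n, measurable_fun D (f_ n)) -> measurable_fun D f ->
  {ae mu, forall x, D x -> f_ n x @[n --> \oo] --> f x} ->
  mu.-integrable D (EFin \o g) ->
  (forall n x, D x -> `|f_ n x| <= g x) ->
  \int[mu]_(x in D) f_ n x @[n --> \oo] --> \int[mu]_(x in D) f x.
Proof.
move=> mD mf_ mf f_f ig f_g.
have [||||fi _ cv] := @dominated_convergence _ _ _ mu _ mD
  (fun n => EFin \o f_ n) (EFin \o f) (EFin \o g) _ _ _ ig.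
- by move=> n; exact/measurable_EFinP.
- exact/measurable_EFinP.
- by apply: filterS f_f => x /= f_fx Dx; apply: cvg_EFin; [exact: nearW|exact: f_fx].
- by apply: aeW => /= x n Dx; rewrite lee_fin f_g.
apply: fine_cvg.
by rewrite fineK//; exact: integrable_fin_num.
Qed.

(** The series starts at the linear term because [h] alone need not be integrable: the factor [y]
    supplies the decay, and |h| |y| e^|y| dominates all partial sums. *)
Lemma integral_expR_series h y :
  measurable_fun setT h -> measurable_fun setT y ->
  mu.-integrable setT (EFin \o (fun x => `|h x| * (`|y x| * expR `|y x|))) ->
  \sum_(k < n) (\int[mu]_x (h x * y x ^+ k.+1)) / k.+1`!%:R @[n --> \oo] -->
  \int[mu]_x (h x * (expR (y x) - 1)).
Proof.
move=> mh my hi.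
have mk (k : nat) : measurable_fun setT (fun x => h x * y x ^+ k.+1).
  by apply: measurable_funM => //; exact: measurable_funX.
have ms (n : nat) :
    measurable_fun setT (fun x => h x * \sum_(k < n) y x ^+ k.+1 / k.+1`!%:R).
  apply: measurable_funM => //; apply: measurable_sum => i.
  by apply: measurable_funM => //; exact: measurable_funX.
have bs n x : `|h x * \sum_(k < n) y x ^+ k.+1 / k.+1`!%:R| <=
    `|h x| * (`|y x| * expR `|y x|).
  by rewrite normrM ler_wpM2l// norm_expR_series1.
have ik (k : nat) : mu.-integrable setT (EFin \o (fun x => h x * y x ^+ k.+1)).
  apply: (@le_integrableR _ _
    (fun x => k`!%:R * (`|h x| * (`|y x| * expR `|y x|)))) => //.
    move=> x _; rewrite normrM normrX mulrCA ler_wpM2l// exprS mulrCA ler_wpM2l//.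
    rewrite -ler_pdivrMl ?ltr0n ?fact_gt0// mulrC exprn_div_fact_le//.
  exact: integrableZR.
have -> : (fun n : nat => \sum_(k < n) (\int[mu]_x (h x * y x ^+ k.+1)) / k.+1`!%:R) =
    (fun n => \int[mu]_x (h x * \sum_(k < n) y x ^+ k.+1 / k.+1`!%:R)).
  apply/funext => n; elim: n => [|n ih].
    rewrite big_ord0; under eq_Rintegral do rewrite big_ord0 mulr0.
    by rewrite /Rintegral integral0.
  rewrite big_ord_recr/= {}ih.
  rewrite -(RintegralZr _ (f := fun x => h x * y x ^+ n.+1)) //.
  rewrite -RintegralD//.
  - by apply: eq_Rintegral => x _; rewrite big_ord_recr/= mulrDr mulrA.
  - exact: (@le_integrableR _ _ (fun x => `|h x| * (`|y x| * expR `|y x|))).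
  - have := integrableZR (n.+1`!%:R)^-1 measurableT (ik n).
    by under eq_fun do rewrite mulrC.
apply: (dominated_convergenceR (g := fun x => `|h x| * (`|y x| * expR `|y x|))) => //.
- by apply: measurable_funM => //; apply: measurable_funB => //; exact: measurableT_comp.
- apply: aeW => x _; apply: cvgM; first exact: cvg_cst.
  exact: is_cvg_expR_series1.
Qed.

(** With N = n + 1, the kernel 1 - exp(-e^(N (a - theta))) tends to the indicator of a > theta, so
    the integral of [F n] tends to the wanted one. Expanding the kernel expresses the same integral
    through the moments of exponents N, 2N, 3N, ..., all bounded by [C]. With z = e^(-N theta) <= 1
    the sum is at most C z e^z <= C e z, which tends to 0. *)
Lemma phragmen_mikusinski h (a : T -> R) (A C theta : R) :
  measurable_fun setT h -> measurable_fun setT a -> (forall x, a x <= A) ->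
  mu.-integrable setT (EFin \o (fun x => `|h x| * expR (a x))) ->
  (forall n : nat, `|\int[mu]_x (h x * expR (n.+1%:R * a x))| <= C) ->
  0 < theta -> {ae mu, forall x, a x != theta} ->
  \int[mu]_(x in [set x | theta < a x]) h x = 0.
Proof.
move=> mh ma aA hi hC t0 at0.
pose F n x := h x * (1 - expR (- expR (n.+1%:R * (a x - theta)))).
have mexp n : measurable_fun setT (fun x => expR (n.+1%:R * (a x - theta))).
  apply: measurableT_comp => //; apply: measurable_funM => //.
  exact: measurable_funB.
have mF n : measurable_fun setT (F n).
  apply: measurable_funM => //; apply: measurable_funB => //.
  by apply: measurableT_comp => //; exact: measurableT_comp.
have mD : d.-measurable [set x | theta < a x].
  rewrite (_ : [set x | _] = a @^-1` `]theta, +oo[); last first.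
    by apply/seteqP; split => x; rewrite /= in_itv/= andbT.
  by rewrite -[X in measurable X]setTI; exact: ma.
have hi' : mu.-integrable setT (EFin \o (fun x => `|h x| * expR (a x - theta))).
  have := integrableZR (expR (- theta)) measurableT hi.
  by under eq_fun do rewrite mulrCA -expRD addrC.
have cvF : \int[mu]_x F n x @[n --> \oo] --> \int[mu]_(x in [set x | theta < a x]) h x.
  rewrite Rintegral_mkcond.
  apply: (dominated_convergenceR _ _ _ _ hi') => //.
  - by apply: (measurable_restrictT _ _).1 => //; exact: measurable_funTS.
  - apply: filterS at0 => x /= axt _; rewrite patchE.
    have geo (s : R) : s < 0 -> expR (n.+1%:R * s) @[n --> \oo] --> 0.
      move=> s0; under eq_fun do rewrite expRM_natl.
      have : (fun n => expR s ^+ n) @ \oo --> 0.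
        by apply: cvg_expr; rewrite ger0_norm ?expR_ge0// expR_lt1.
      by rewrite -cvg_shiftS.
    case: ifPn; rewrite ?notin_setE ?inE /= => xt.
      rewrite -[X in _ --> X]mulr1; apply: cvgM; first exact: cvg_cst.
      rewrite -[X in _ --> X]subr0; apply: cvgB; first exact: cvg_cst.
      have tx : theta - a x < 0 by rewrite subr_lt0.
      apply: (squeeze_cvgr _ (cvg_cst (0 : R)) (geo _ tx)).
        apply: nearW => n; rewrite expR_ge0/= ler_expR.
        rewrite -[X in _ <= _ * X]opprB mulrN lerN2; apply: le_trans (expR_ge1Dx _).
        by rewrite lerDr.
    rewrite -[X in _ --> X](mulr0 (h x)); apply: cvgM; first exact: cvg_cst.
    rewrite -[X in _ --> X](subrr 1); apply: cvgB; first exact: cvg_cst.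
    rewrite -[X in _ --> X]expR0; apply: continuous_cvg; first exact: continuous_expR.
    rewrite -[X in _ --> X]oppr0; apply: cvgN; apply: geo.
    by rewrite subr_lt0 lt_neqAle axt leNgt; apply/negP.
  (* Domination uniform in n: 1 - e^(-s) is at most 1 and at most s; the first bound is below e^(a -
     theta) where a >= theta, the second where a < theta. *)
  - move=> n x _; rewrite normrM ler_wpM2l//.
    have e0 := expR_gt0 (n.+1%:R * (a x - theta)).
    rewrite ger0_norm; last by rewrite subr_ge0 expR_le1 oppr_le0 ltW.
    have [ta|ta] := leP 0 (a x - theta).
      apply: (@le_trans _ _ 1); first by rewrite gerBl expR_ge0.
      by rewrite -[leLHS]expR0 ler_expR.
    apply: (@le_trans _ _ (expR (n.+1%:R * (a x - theta)))).
      by rewrite lerBlDr -lerBlDl; apply: le_trans (expR_ge1Dx _); rewrite addrC.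
    by rewrite ler_expR -[leRHS]mul1r ler_wnM2r ?ler1n// ltW.
have ip p : mu.-integrable setT (EFin \o (fun x => h x * expR (p.+1%:R * a x))).
  have := integrableZR (expR (p%:R * A)) measurableT hi.
  apply: le_integrableR => //.
    apply: measurable_funM => //; apply: measurableT_comp => //.
    exact: measurable_funM.
  move=> x _; rewrite normrM (ger0_norm (expR_ge0 _)) [leRHS]mulrCA ler_wpM2l//.
  by rewrite -expRD ler_expR -natr1 mulrDl mul1r lerD2r ler_wpM2l.
have bF n : `|\int[mu]_x F n x| <= C * expR 1 * expR (n.+1%:R * - theta).
  have z1 : expR (n.+1%:R * - theta) <= 1.
    by rewrite expR_le1 mulr_ge0_le0// oppr_le0 ltW.
  have z0 := expR_ge0 (n.+1%:R * - theta).
  set z := expR _ in z1 z0 *.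
  have C0 : 0 <= C by exact: le_trans (hC 0%N).
  pose y x := - expR (n.+1%:R * (a x - theta)).
  have -> : \int[mu]_x F n x = \int[mu]_x (- h x * (expR (y x) - 1)).
    by apply: eq_Rintegral => x _; rewrite /F mulNr -mulrN opprB.
  have my : measurable_fun setT y by exact: measurableT_comp.
  have hy : mu.-integrable setT
      (EFin \o (fun x => `|- h x| * (`|y x| * expR `|y x|))).
    have := integrableZR (expR (expR (n.+1%:R * (A - theta))) *
      expR (n%:R * (A - theta))) measurableT hi'.
    apply: le_integrableR => //.
      have mny : measurable_fun setT (fun x => `|y x|) by exact: measurableT_comp.
      apply: measurable_funM.
        by apply: measurableT_comp => //; exact: measurableT_comp.
      by apply: measurable_funM => //; exact: measurableT_comp.
    move=> x _; rewrite !normrM !normr_id normrN [leRHS]mulrCA ler_wpM2l//.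
    have yE : `|y x| = expR (n.+1%:R * (a x - theta)).
      by rewrite /y normrN ger0_norm// expR_ge0.
    rewrite yE (ger0_norm (expR_ge0 _)) mulrC -[leRHS]mulrA.
    apply: ler_pM; rewrite ?expR_ge0//.
      by rewrite !ler_expR ler_wpM2l// lerD2r.
    rewrite -expRD ler_expR -natr1 mulrDl mul1r lerD2r ler_wpM2l// lerD2r//.
  have mNh : measurable_fun setT (fun x => - h x) by exact: measurableT_comp.
  have := integral_expR_series mNh my hy.
  move=> /cvg_norm /cvg_lim <-//.
  apply: limr_le.
    by apply/cvg_ex; eexists; apply: cvg_norm; exact: integral_expR_series.
  apply: nearW => m.
  apply: (@le_trans _ _ (C * \sum_(k < m) z ^+ k.+1 / k.+1`!%:R)).
    apply: le_trans (ler_norm_sum _ _ _) _.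
    rewrite mulr_sumr; apply: ler_sum => k _.
    rewrite normrM (ger0_norm (x := (_)^-1))// mulrA ler_wpM2r//.
    (* A power of the exponential is again a moment; the exponent (n + 1)(k + 1) is written as a
       successor to match the hypothesis on moments. *)
    have -> : \int[mu]_x (- h x * y x ^+ k.+1) =
        \int[mu]_x (((-1) ^+ k * z ^+ k.+1) *
          (h x * expR ((n.+1 * k + n).+1%:R * a x))).
      apply: eq_Rintegral => x _.
      rewrite /y [(- _) ^+ k.+1]exprNn (exprS (- 1 : R)).
      have -> : expR (n.+1%:R * (a x - theta)) ^+ k.+1 =
          z ^+ k.+1 * expR ((n.+1 * k + n).+1%:R * a x).
        have -> : (n.+1 * k + n).+1 = (n.+1 * k.+1)%N.
          by rewrite mulnS addnC addSn.
        by rewrite /z -!expRM_natl -expRD natrM; congr expR; ring.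
      by ring.
    rewrite RintegralZl//.
    rewrite normrM [leRHS]mulrC ler_pM//.
    by rewrite normrM normrX normrN1 expr1n mul1r ger0_norm// exprn_ge0.
  rewrite -mulrA ler_wpM2l//; apply: le_trans (ler_norm _) _.
  apply: le_trans (norm_expR_series1 _ _) _.
  by rewrite ger0_norm// mulrC ler_wpM2r// ler_expR.
have : \int[mu]_x F n x @[n --> \oo] --> 0.
  apply/norm_cvg0P.
  have e1 : expR (- theta) < 1 by rewrite expR_lt1 oppr_lt0.
  apply: (squeeze_cvgr (f := cst 0)
    (h := fun n => C * expR 1 * expR (n.+1%:R * - theta))).
  - by apply: nearW => n; rewrite /= normr_ge0/= bF.
  - exact: cvg_cst.
  - rewrite -[X in _ --> X](mulr0 (C * expR 1)); apply: cvgM; first exact: cvg_cst.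
    under eq_fun do rewrite expRM_natl.
    have : (fun n => expR (- theta) ^+ n) @ \oo --> 0.
      by apply: cvg_expr; rewrite ger0_norm ?expR_ge0.
    by rewrite -cvg_shiftS.
by move=> /(cvg_unique _ cvF) => ->.
Qed.

End integration.

Section integration_lebesgue.
Context {R : realType}.
Notation mu := (@lebesgue_measure R).

Lemma oneDsqr_gt0 (x : R) : 0 < oneDsqr x.
Proof. exact: lt_le_trans (oneDsqr_ge1 x). Qed.

Lemma integrable_inv_oneDsqr :
  mu.-integrable setT (EFin \o (fun x : R => (oneDsqr x)^-1)).
Proof.
apply/integrableP; split.
  apply/measurable_EFinP; apply: continuous_measurable_fun => x. exact: continuous_oneDsqrV.
under eq_integral do rewrite gee0_abs ?lee_fin ?invr_ge0 ?(ltW (oneDsqr_gt0 _))//.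
have -> : (\int[mu]_x (EFin \o (fun x : R => (oneDsqr x)^-1%R)) x =
    2%:E * \int[mu]_(x in [set x | (0 <= x)%R]) ((oneDsqr x)^-1)%:E)%E.
  apply: ge0_symfun_integralT.
  - by move=> x; rewrite invr_ge0 (ltW (oneDsqr_gt0 _)).
  - exact: continuous_oneDsqrV.
  - by move=> x; rewrite /= /oneDsqr sqrrN.
have -> : [set x : R | 0 <= x] = `[0, +oo[%classic.
  by apply/seteqP; split => x; rewrite /= in_itv/= andbT.
by rewrite integral0y_oneDsqr -EFinM ltry.
Qed.

End integration_lebesgue.

(** * Functions determined almost everywhere by their integrals over intervals *)

Section vanishing.
Context {R : realType}.
Notation mu := (@lebesgue_measure R).

(** Lebesgue differentiation: almost everywhere [h] is the derivative of its primitive, which is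
    constant near each point of the open set [U]. *)
Lemma ae_eq0_primitive (h : R -> R) (U : set R) (k : R) : open U ->
  mu.-integrable setT (EFin \o h) ->
  (forall x, U x -> \int[mu]_(t in `]-oo, x]) h t = k) ->
  {ae mu, forall x, U x -> h x = 0}.
Proof.
move=> oU hi hk.
have := @FTC1Ny R h _ _.
have hloc : locally_integrable [set: R] h.
  by apply: open_integrable_locally => //; exact: openT.
have hiy y : mu.-integrable `]-oo, y] (EFin \o h) by apply: integrableS hi.
move=> /(_ hiy hloc) /=; apply: filterS; first exact: (ae_filter_ringOfSetsType mu).
move=> x [_ <-] Ux.
rewrite derive1E (near_eq_derive (g := cst k)) ?derive_cst//.
have := open_nbhs_nbhs (conj oU Ux).
by apply: filterS => z /hk.
Qed.

Lemma ae_eq0_balls (f : R -> R) : measurable_fun setT f ->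
  (forall n : nat, mu.-integrable `]- n%:R, n%:R[ (EFin \o f)) ->
  (forall c r : R, 0 < r -> \int[mu]_(x in [set x | `|x - c| < r]) f x = 0) ->
  {ae mu, forall x, f x = 0}.
Proof.
move=> mf fi f0.
suff : {ae mu, forall x, forall n : nat, `]- n%:R, n%:R[%classic x -> f x = 0}.
  apply: filterS; first exact: (ae_filter_ringOfSetsType mu).
  move=> x /(_ (Num.bound `|x|)); apply => /=.
  by rewrite in_itv/= -ltr_norml archi_boundP.
apply/ae_foralln => n.
pose D : set R := `]- n%:R, n%:R[%classic.
have mD : measurable D by exact: measurable_itv.
have := @ae_eq0_primitive (f \_ D) D 0 _ _ _.
have i1 : mu.-integrable setT (EFin \o (f \_ D)).
  by apply: integrable_patch => //; exact: fi.
move=> /(_ (interval_open _ _) i1) H.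
have {}H : {ae mu, forall x, D x -> (f \_ D) x = 0}.
  apply: H => // x; rewrite /D/= in_itv/= => /andP[nx xn].
  rewrite -Rintegral_mkcondr.
  have -> : `]-oo, x] `&` D = `]- n%:R, x]%classic.
    apply/seteqP; split => z; rewrite /D/= !in_itv/=.
      by move=> [-> /andP[-> _]].
    by move=> /andP[-> zx]; split => //; rewrite (le_lt_trans zx).
  (* Without its endpoint x, the interval ]-n, x] is the ball of centre (x - n)/2 and radius (x +
     n)/2. *)
  rewrite -Rintegral_itv_bndo_bndc; last first.
    apply: integrableS (fi n) => //.
    by apply: subset_itvl; rewrite bnd_simp ltW.
  have x0 : 0 < (x + n%:R) / 2 by lra.
  rewrite -[RHS](f0 ((x - n%:R) / 2) _ x0); congr Rintegral.
  apply/seteqP; split => z; rewrite /= in_itv/= ltr_norml.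
    by move=> /andP[? ?]; apply/andP; split; lra.
  by move=> /andP[? ?]; apply/andP; split; lra.
apply: filterS H; first exact: (ae_filter_ringOfSetsType mu).
move=> x Hx Dx.
by rewrite -(Hx Dx) patchE mem_set.
Qed.

End vanishing.

(** * Uniform boundedness on bounded subsets of H^2 *)

Section uniform_boundedness.
Context {R : realType}.

Section gliding_hump.
Variables (I E : Type) (B : E -> Prop) (phi : I -> E -> R) (c : I -> R).
Hypothesis phi_bound : forall t f, B f -> `|phi t f| <= c t.
(** Stands in for completeness and linearity: [E] carries no vector space structure, so the sum of a
    weighted series is asked to exist only through its values, bounded uniformly in [t]. *)
Hypothesis phi_series : forall (f : nat -> E) (e : nat -> R),
  (forall n, B (f n)) -> (forall n, `|e n| <= 3^-1 ^+ n) ->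
  exists M : R, forall t, exists2 l : R, `|l| <= M &
    \sum_(k < n) e k * phi t (f k) @[n --> \oo] --> l.

(** For a fixed [t] the supremum over [B] is finite by [phi_bound]; a member exceeding two thirds of
    it is chosen, whence the factor 3/2. *)
Lemma almost_extremal (K : R) : 0 < K ->
  (exists t f, B f /\ 2 * K < `|phi t f|) ->
  exists tf : I * E, [/\ B tf.2, K <= `|phi tf.1 tf.2| &
    forall f, B f -> `|phi tf.1 f| <= 3 / 2 * `|phi tf.1 tf.2|].
Proof.
move=> K0 [t [f [Bf Kf]]].
pose S := [set r | exists2 f, B f & r = `|phi t f|].
have hS : has_sup S.
  by split; [exists `|phi t f|, f|exists (c t) => _ [f' Bf' ->]; exact: phi_bound].
have fS : `|phi t f| <= sup S by apply: ub_le_sup; [exact: hS.2|exists f].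
have [_ [f' Bf' ->] ltf'] : exists2 e, S e & sup S - sup S / 3 < e.
  by apply: sup_adherent => //; lra.
exists (t, f'); split => //=; first by lra.
move=> f'' Bf''; apply: (@le_trans _ _ (sup S)); last by lra.
by apply: ub_le_sup; [exact: hS.2|exists f''].
Qed.

(* Signs are chosen so that the k-th hump never cancels against the earlier
   ones; the geometric weights keep the later ones below 3/4 of it. *)
Lemma gliding_hump : exists K : R, forall t f, B f -> `|phi t f| <= K.
Proof.
apply: contrapT => noK.
have big (K : R) : exists t f, B f /\ K < `|phi t f|.
  apply: contrapT => nK; apply: noK; exists K => t f Bf.
  by rewrite leNgt; apply/negP => Kf; apply: nK; exists t, f.
have /choice[tf tfP] : forall k : nat, exists tf : I * E,
    [/\ B tf.2, 4 ^+ k <= `|phi tf.1 tf.2| &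
    forall f, B f -> `|phi tf.1 f| <= 3 / 2 * `|phi tf.1 tf.2|].
  by move=> k; apply: almost_extremal => //; rewrite exprn_gt0.
pose q k : R := 3^-1 ^+ k.
have q0 k : 0 < q k by rewrite exprn_gt0.
have qS k : q k.+1 = q k / 3 by rewrite /q exprS mulrC.
pose sg (a b : R) : R := if 0 <= a * b then 1 else -1.
have sg1 a b : `|sg a b| = 1 by rewrite /sg; case: ifP; rewrite ?normrN normr1.
have sgP a b (p : R) : 0 < p -> p * `|b| <= `|a + sg a b * p * b|.
  move=> p0; rewrite /sg -{1}(gtr0_norm p0) -normrM.
  rewrite -ler_sqr ?nnegrE// !real_normK ?num_real//.
  have pp : 0 <= p * p by rewrite mulr_ge0// ltW.
  have aa := sqr_ge0 a.
  case: ifPn => ab; first by rewrite !expr2; nra.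
  by rewrite -ltNge in ab; rewrite !expr2; nra.
pose A := fix A (k : nat) (t : I) : R := if k is k'.+1 then
   A k' t + sg (A k' (tf k').1) (phi (tf k').1 (tf k').2) * q k' * phi t (tf k').2
   else 0.
pose e k := sg (A k (tf k).1) (phi (tf k).1 (tf k).2) * q k.
have AE n t : A n t = \sum_(k < n) e k * phi t (tf k).2.
  by elim: n => [|n ih]; rewrite ?big_ord0// big_ord_recr/= -ih.
have eq k : `|e k| = q k by rewrite normrM sg1 mul1r gtr0_norm.
have [M HM] : exists M : R, forall t, exists2 l : R, `|l| <= M &
    \sum_(k < n) e k * phi t (tf k).2 @[n --> \oo] --> l.
  by apply: (phi_series (f := fun k => (tf k).2)) => n; [case: (tfP n)|rewrite eq].
have hump k : q k * 4 ^+ k <= 4 * M.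
  have [Bk kb ext] := tfP k; have [l lM Al] := HM (tf k).1.
  set b := `|phi _ _| in kb ext.
  have lb : q k * b <= `|A k.+1 (tf k).1| by exact: sgP.
  (* Each later hump is at most 3/2 b times its weight, and the weights from [k.+1] up to [k + m]
     sum to 3/2 (q_(k+1) - q_(k+1+m)); the product of the two factors is 9/4. *)
  have tail m : `|A (k.+1 + m)%N (tf k).1 - A k.+1 (tf k).1| <=
      9 / 4 * b * (q k.+1 - q (k.+1 + m)%N).
    elim: m => [|m ih]; first by rewrite addn0 !subrr normr0 mulr0.
    have -> : A (k.+1 + m.+1)%N (tf k).1 = A (k.+1 + m)%N (tf k).1 +
        e (k.+1 + m)%N * phi (tf k).1 (tf (k.+1 + m)%N).2 by rewrite addnS.
    rewrite addnS (qS (k.+1 + m)%N) addrAC; apply: le_trans (ler_normD _ _) _.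
    have := ext (tf (k.+1 + m)%N).2; case: (tfP (k.+1 + m)%N) => Bm _ _ /(_ Bm) extm.
    have : `|e (k.+1 + m)%N * phi (tf k).1 (tf (k.+1 + m)%N).2| <=
        q (k.+1 + m)%N * (3 / 2 * b).
      by rewrite normrM eq ler_wpM2l// ltW.
    by move: ih; nra.
  have tl : `|l - A k.+1 (tf k).1| <= 9 / 4 * b * q k.+1.
    have cv : `|A (k.+1 + m)%N (tf k).1 - A k.+1 (tf k).1| @[m --> \oo] -->
        `|l - A k.+1 (tf k).1|.
      apply: cvg_norm; apply: cvgB; last exact: cvg_cst.
      have : A n (tf k).1 @[n --> \oo] --> l by under eq_fun do rewrite AE.
      by rewrite -(cvg_shiftn k.+1); under eq_fun do rewrite addnC.
    rewrite -(cvg_lim _ cv)//; apply: limr_le; first by apply/cvg_ex; eexists; exact: cv.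
    apply: nearW => m; apply: le_trans (tail m) _.
    rewrite ler_wpM2l ?mulr_ge0// ?gerBl; last exact: ltW.
    by rewrite normr_ge0.
  (* The limit keeps at least a quarter of the k-th hump, so q_k b <= 4 M. *)
  have : q k * 4 ^+ k <= q k * b by rewrite ler_wpM2l// ltW.
  have : `|A k.+1 (tf k).1| <= `|l| + `|l - A k.+1 (tf k).1|.
    by rewrite -[X in `|X| <= _](subKr l); exact: ler_normB.
  by move: tl; rewrite qS; lra.
have M0 : 0 <= M by have := hump 0%N; rewrite /q !expr0; lra.
(* Bernoulli's inequality for (4/3)^n; any n > 12 M then contradicts [hump]. *)
have bern n : 1 + n%:R / 3 <= q n * 4 ^+ n.
  elim: n => [|n ih]; first by rewrite /q !expr0 mul0r addr0 mulr1.
  rewrite qS [4 ^+ n.+1]exprS -natr1.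
  have -> : q n / 3 * (4 * 4 ^+ n) = (q n * 4 ^+ n) * (4 / 3) by ring.
  have : 0 <= n%:R :> R by [].
  by move: ih; lra.
have := archi_boundP (mulr_ge0 (ler0n R 12) M0).
set n := Num.bound _ => nM.
by have := hump n; have := bern n; lra.
Qed.

End gliding_hump.
End uniform_boundedness.

Section test_functions.
Context {R : realType}.
Notation mu := (@lebesgue_measure R).

Lemma derivable_continuous (f : R -> R) : (forall x, derivable f x 1) -> continuous f.
Proof. by move=> df x; exact/differentiable_continuous/derivable1_diffP. Qed.

Lemma continuous_test_function (psi : R -> R) n : test_function psi ->
  continuous (derive1n n psi).
Proof. by move=> [dpsi _]; apply: derivable_continuous => x. Qed.

Arguments continuous_test_function {psi} n.

Lemma derive1n_vanish (psi : R -> R) (M : R) n :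
  (forall x, M < `|x| -> psi x = 0) ->
  forall x, M < `|x| -> derive1n n psi x = 0.
Proof.
move=> psi0; elim: n => [//|n ih] x Mx; rewrite derive1nS derive1E.
rewrite (near_eq_derive (g := cst 0)) ?derive_cst//.
have oU : open [set z : R | M < `|z|].
  apply: (@open_comp _ _ (@Num.norm _ R) [set y | M < y]) => [y _|].
    exact: norm_continuous.
  exact: open_gt.
by apply: filterS (open_nbhs_nbhs (conj oU Mx)) => z; exact: ih.
Qed.

Arguments derive1n_vanish {psi M} n.

Lemma integrable_test_function (psi : R -> R) n : test_function psi ->
  mu.-integrable setT (EFin \o derive1n n psi).
Proof.
move=> tpsi; have cpsi := continuous_test_function n tpsi.
have [_ [M /(derive1n_vanish n) psi0]] := tpsi.
have i1 : mu.-integrable `[- M, M] (EFin \o derive1n n psi).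
  apply: continuous_compact_integrable; first exact: segment_compact.
  exact: continuous_subspaceT.
have : mu.-integrable setT (EFin \o (derive1n n psi \_ `[- M, M])).
  by apply: integrable_patch => //; exact: i1.
apply: eq_integrable => // x _ /=; congr EFin.
rewrite patchE; case: ifPn => //; rewrite notin_setE/= in_itv/= -ler_norml => /negP.
by rewrite -ltNge => /psi0.
Qed.

Arguments integrable_test_function {psi} n.

Lemma derive1n_shift (psi : R -> R) n : derive1n n (derive1n 1 psi) = derive1n n.+1 psi.
Proof. by elim: n => [//|n ih]; rewrite derive1nS ih derive1nS. Qed.

Lemma test_function_derive (psi : R -> R) : test_function psi ->
  test_function (derive1n 1 psi).
Proof.
move=> [dpsi [M psi0]]; split; last by exists M; exact: derive1n_vanish.
by move=> n x; rewrite derive1n_shift; exact: dpsi.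
Qed.

End test_functions.
Arguments continuous_test_function {R psi} n.
Arguments integrable_test_function {R psi} n.

(** * Weighted 2-jets: completeness and uniform boundedness *)

Section h2_ball.
Context {R : realType}.
Notation mu := (@lebesgue_measure R).

Definition real_weak_derivative (f g : R -> R) : Prop :=
  forall psi, test_function psi ->
    \int[mu]_x (f x * derive1n 1 psi x) = - \int[mu]_x (g x * psi x).

(* Bounded subsets of H^2 with an explicit decay, given by 2-jets. *)
Definition h2_ball (C : R) (F : nat -> R -> R) : Prop :=
  (forall j, (j <= 2)%N -> measurable_fun setT (F j) /\
    forall x, `|F j x| <= C * (oneDsqr x)^-1) /\
  forall j, (j < 2)%N -> real_weak_derivative (F j) (F j.+1).

Lemma oneDsqrV_ge0 (x : R) : 0 <= (oneDsqr x)^-1.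
Proof. by rewrite invr_ge0 ltW// oneDsqr_gt0. Qed.

Lemma integrable_test_function_decay psi n : test_function psi ->
  mu.-integrable setT (EFin \o (fun x => derive1n n psi x * (oneDsqr x)^-1)).
Proof.
move=> tpsi; have := integrable_norm (integrable_test_function n tpsi).
apply: le_integrableR => //.
  apply: measurable_funM; apply: continuous_measurable_fun.
    exact: continuous_test_function.
  exact: continuous_oneDsqrV.
move=> x _; rewrite normrM -[leRHS]mulr1 ler_wpM2l// ger0_norm ?oneDsqrV_ge0//.
exact: oneDsqrV_le1.
Qed.

Lemma integrable_norm_decay (w : R -> R) :
  mu.-integrable setT (EFin \o (fun x => w x * (oneDsqr x)^-1)) ->
  mu.-integrable setT (EFin \o (fun x => `|w x| * (oneDsqr x)^-1)).
Proof.
move=> iw; have := integrable_norm iw.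
apply: eq_integrable => // x _; congr EFin.
by rewrite /= normrM [X in _ * X]ger0_norm// oneDsqrV_ge0.
Qed.

Lemma integrable_pairing (w f : R -> R) (C : R) :
  measurable_fun setT w -> measurable_fun setT f ->
  (forall x, `|f x| <= C * (oneDsqr x)^-1) ->
  mu.-integrable setT (EFin \o (fun x => w x * (oneDsqr x)^-1)) ->
  mu.-integrable setT (EFin \o (fun x => w x * f x)).
Proof.
move=> mw mf fC /integrable_norm_decay iw.
apply: le_integrableR (integrableZR C measurableT iw) => //.
  exact: measurable_funM.
by move=> x _; rewrite normrM [leRHS]mulrCA ler_wpM2l.
Qed.

Lemma h2_ball_scale (C c : R) (F : nat -> R -> R) : 0 <= c -> h2_ball C F ->
  h2_ball (c * C) (fun j x => c * F j x).
Proof.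
move=> c0 [hF dF]; split.
  move=> j j2; have [mF bF] := hF j j2; split; first exact: measurable_funM.
  by move=> x; rewrite normrM (ger0_norm c0) -mulrA ler_wpM2l.
have iF psi n j : test_function psi -> (j <= 2)%N ->
    mu.-integrable setT (EFin \o (fun x => F j x * derive1n n psi x)).
  move=> tpsi j2; have [mF bF] := hF j j2.
  under eq_fun do rewrite mulrC.
  apply: integrable_pairing bF _ => //.
    by apply: continuous_measurable_fun; exact: continuous_test_function.
  exact: integrable_test_function_decay.
move=> j j2 psi tpsi; under eq_Rintegral do rewrite -mulrA.
under [in RHS]eq_Rintegral do rewrite -mulrA.
rewrite RintegralZl//; last by apply: iF => //; exact: ltnW.
rewrite RintegralZl//; last exact: (iF psi 0%N).
by rewrite dF// mulrN.
Qed.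

Section series.
Variables (F : nat -> nat -> R -> R) (e : nat -> R).
Hypothesis hF : forall n, h2_ball 1 (F n).
Hypothesis he : forall n, `|e n| <= 3^-1 ^+ n.

Let S n j x := \sum_(k < n) e k * F k j x.

Let mS n j : (j <= 2)%N -> measurable_fun setT (S n j).
Proof.
move=> j2; apply: measurable_sum => i; apply: measurable_funM => //.
by have [/(_ j j2)[]] := hF i.
Qed.

Let geo n : \sum_(k < n) (3^-1 : R) ^+ k <= 3 / 2.
Proof.
suff -> : \sum_(k < n) (3^-1 : R) ^+ k = 3 / 2 * (1 - 3^-1 ^+ n).
  have : 0 <= (3^-1 : R) ^+ n by rewrite exprn_ge0.
  by lra.
elim: n => [|n ih]; first by rewrite big_ord0 expr0 subrr mulr0.
by rewrite big_ord_recr/= ih exprS; field.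
Qed.

Let bS n j x : (j <= 2)%N -> `|S n j x| <= 3 / 2 * (oneDsqr x)^-1.
Proof.
move=> j2; apply: le_trans (ler_norm_sum _ _ _) _.
apply: (@le_trans _ _ (\sum_(k < n) 3^-1 ^+ k * (oneDsqr x)^-1)).
  apply: ler_sum => k _; rewrite normrM ler_pM//.
  by have [/(_ j j2)[_ /(_ x)]] := hF k; rewrite mul1r.
by rewrite -mulr_suml ler_wpM2r ?oneDsqrV_ge0.
Qed.

Let cS j x : (j <= 2)%N -> cvgn (fun n => S n j x).
Proof.
move=> j2.
have -> : (fun n => S n j x) = series (fun k => e k * F k j x).
  by apply/funext => n; rewrite /series/= big_mkord.
apply: normed_cvg.
apply: (series_le_cvg (v_ := geometric 1 3^-1)) => //=.
- move=> n; rewrite normrM mul1r -[leRHS]mulr1.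
  have [/(_ j j2)[_ /(_ x)]] := hF n; rewrite mul1r => Fx _.
  by apply: ler_pM => //; apply: le_trans Fx _; exact: oneDsqrV_le1.
- by apply: is_cvg_geometric_series; rewrite ger0_norm//; lra.
Qed.

Let G j x := limn (fun n => S n j x).

Let cG j x : (j <= 2)%N -> S n j x @[n --> \oo] --> G j x.
Proof. by move=> /cS. Qed.

Let mG j : (j <= 2)%N -> measurable_fun setT (G j).
Proof.
move=> j2; apply: (measurable_fun_cvg (h := fun n => S n j)).
  by move=> m; exact: mS.
by move=> x _; exact: cG.
Qed.

(** Serves twice: for a general weight [w] it gives convergence of the pairings, and for [w] a test
    function or its derivative it carries the weak derivative relation to the limit. *)
Let cvg_pairing (w : R -> R) j : (j <= 2)%N -> measurable_fun setT w ->
  mu.-integrable setT (EFin \o (fun x => w x * (oneDsqr x)^-1)) ->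
  \sum_(k < n) e k * \int[mu]_x (w x * F k j x) @[n --> \oo] -->
  \int[mu]_x (w x * G j x).
Proof.
move=> j2 mw iw.
have iw' := integrable_norm_decay iw.
have iF k : mu.-integrable setT (EFin \o (fun x => w x * F k j x)).
  by have [/(_ j j2)[mF bF] _] := hF k; exact: integrable_pairing bF iw.
have -> : (fun n : nat => \sum_(k < n) e k * \int[mu]_x (w x * F k j x)) =
    (fun n => \int[mu]_x (w x * S n j x)).
  apply/funext => n; elim: n => [|n ih].
    rewrite big_ord0 /S; under eq_Rintegral do rewrite big_ord0 mulr0.
    by rewrite /Rintegral integral0.
  rewrite big_ord_recr/= ih -RintegralZl// -RintegralD//.
  - by apply: eq_Rintegral => x _; rewrite /S big_ord_recr/=; ring.
  - apply: le_integrableR (integrableZR (3 / 2) measurableT iw') => //.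
      by apply: measurable_funM => //; exact: mS.
    move=> x _; rewrite normrM [leRHS]mulrCA ler_wpM2l//; exact: bS.
  - exact: integrableZR.
apply: (dominated_convergenceR _ _ _ _ (integrableZR (3 / 2) measurableT iw')) => //.
- by move=> n; apply: measurable_funM => //; exact: mS.
- by apply: measurable_funM => //; exact: mG.
- by apply: aeW => x _; apply: cvgM; [exact: cvg_cst|exact: cG].
- by move=> n x _; rewrite normrM [leRHS]mulrCA ler_wpM2l//; exact: bS.
Qed.

(** The weights 3^-k sum to 3/2, which is the radius of the limit. The explicit decay makes the
    pointwise limit a dominated one, so no H^2 convergence has to be considered. *)
Lemma h2_ball_series : exists G : nat -> R -> R, h2_ball (3 / 2) G /\
  forall w : R -> R, measurable_fun setT w ->
    mu.-integrable setT (EFin \o (fun x => w x * (oneDsqr x)^-1)) ->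
    \sum_(k < n) e k * \int[mu]_x (w x * F k 0%N x) @[n --> \oo] -->
    \int[mu]_x (w x * G 0%N x).
Proof.
exists G; split; last by move=> w mw iw; exact: cvg_pairing.
split.
  move=> j j2; split; first exact: mG.
  move=> x; have cx : `|S n j x| @[n --> \oo] --> `|G j x| by apply: cvg_norm; exact: cG.
  rewrite -(cvg_lim _ cx)//.
  apply: limr_le; first by apply/cvg_ex; eexists; exact: cx.
  by apply: nearW => n; exact: bS.
move=> j j2 psi tpsi.
have wi n := @integrable_test_function_decay psi n tpsi.
have mpsi n : measurable_fun setT (derive1n n psi).
  by apply: continuous_measurable_fun; exact: continuous_test_function.
under eq_Rintegral do rewrite mulrC.
under [in RHS]eq_Rintegral do rewrite mulrC.
have h1 := cvg_pairing (ltnW j2) (mpsi 1%N) (wi 1%N).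
have h2 := cvg_pairing j2 (mpsi 0%N) (wi 0%N).
apply: (cvg_unique _ h1) => //.
suff -> : (fun n : nat => \sum_(k < n) e k * \int[mu]_x (derive1n 1 psi x * F k j x)) =
    (fun n => - \sum_(k < n) e k * \int[mu]_x (derive1n 0 psi x * F k j.+1 x)).
  exact: cvgN.
apply/funext => n; rewrite -sumrN; apply: eq_bigr => k _.
have [_ /(_ j j2 psi tpsi)] := hF k.
under eq_Rintegral do rewrite mulrC.
under [X in _ = - X -> _]eq_Rintegral do rewrite mulrC.
by move=> ->; rewrite mulrN.
Qed.

End series.

(** Banach-Steinhaus for the pairings with [w t], t in [A]: a bound for each jet separately becomes
    one on the unit ball, with completeness supplied by [h2_ball_series], and homogeneity restores
    the radius [C]. The maximum with 1 in the proof makes the constant positive. *)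
Lemma uniform_h2_bound (A : set R) (w : R -> R -> R) :
  (forall t, A t -> measurable_fun setT (w t)) ->
  (forall t, A t ->
    mu.-integrable setT (EFin \o (fun x => w t x * (oneDsqr x)^-1))) ->
  (forall C F, h2_ball C F ->
    exists M : R, forall t, A t -> `|\int[mu]_x (w t x * F 0%N x)| <= M) ->
  exists2 K : R, 0 < K & forall C F, 0 < C -> h2_ball C F -> forall t, A t ->
    `|\int[mu]_x (w t x * F 0%N x)| <= C * K.
Proof.
move=> mw iw bw.
have [K HK] : exists K : R, forall (t : {t : R | A t}) F, h2_ball 1 F ->
    `|\int[mu]_x (w (sval t) x * F 0%N x)| <= K.
  apply: (@gliding_hump _ _ _ (h2_ball 1)
    (fun (t : {t : R | A t}) F => \int[mu]_x (w (sval t) x * F 0%N x))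
    (fun t => \int[mu]_x (`|w (sval t) x| * (oneDsqr x)^-1))).
    move=> [t At] F [hF _] /=; have [//|mF bF] := hF 0%N.
    apply: le_norm_Rintegral => //.
    - by apply: measurable_funM => //; exact: mw.
    - exact: integrable_norm_decay (iw t At).
    - by move=> x _; rewrite normrM ler_wpM2l//; have := bF x; rewrite mul1r.
  move=> F e hF he; have [G [hG cvG]] := h2_ball_series hF he.
  have [M HM] := bw _ _ hG.
  exists M => -[t At] /=; exists (\int[mu]_x (w t x * G 0%N x)); first exact: HM.
  by apply: cvG; [exact: mw|exact: iw].
exists (Num.max K 1); first by rewrite lt_max ltr01 orbT.
move=> C F C0 hF t At.
have := h2_ball_scale (ltW (_ : 0 < C^-1)) hF.
rewrite invr_gt0 mulVf ?gt_eqF// => /(_ C0) /(HK (exist _ t At)) /=.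
have [mF bF] := hF.1 0%N isT.
under eq_Rintegral do rewrite mulrCA.
rewrite RintegralZl//; last by apply: integrable_pairing bF _ => //; [exact: mw|exact: iw].
rewrite normrM gtr0_norm ?invr_gt0// ler_pdivrMl// => /le_trans; apply.
by rewrite ler_wpM2l ?(ltW C0)// le_max lexx.
Qed.

End h2_ball.

(** * Duality with the backward heat equation *)

Section duality.
Context {R : realType}.
Notation mu := (@lebesgue_measure R).

Lemma integration_by_parts_test (f g psi : R -> R) :
  (forall x : R, is_derive x 1 f (g x)) -> continuous g -> test_function psi ->
  \int[mu]_x (f x * derive1n 1 psi x) = - \int[mu]_x (g x * psi x).
Proof.
move=> df cg tpsi.
have [dpsi [M psi0]] := tpsi.
(* [N] lies strictly beyond the support, so the boundary terms vanish; the absolute value covers a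
   negative [M]. *)
pose N := `|M| + 1.
have MN : M < N by rewrite ltr_pwDr// ler_norm.
have N0 : - N < N by rewrite gtrN// ltr_wpDl.
have N00 : 0 <= N by rewrite addr_ge0.
have restr (h : R -> R) n : \int[mu]_x (h x * derive1n n psi x) =
    \int[mu]_(x in `[- N, N]) (h x * derive1n n psi x).
  rewrite [RHS]Rintegral_mkcond; apply: eq_Rintegral => x _.
  rewrite patchE; case: ifPn => //; rewrite notin_setE/= in_itv/= -ler_norml => /negP.
  rewrite -ltNge => Nx; rewrite (derive1n_vanish n psi0) ?mulr0//.
  exact: lt_trans Nx.
have cf : continuous f by apply: derivable_continuous => x; have [] := df x.
have cpsi n := @continuous_test_function _ psi n tpsi.
rewrite restr (restr g 0%N) (@Rintegration_by_parts _ f psi g)//.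
- have -> : psi N = 0 by rewrite psi0// ger0_norm.
  have -> : psi (- N) = 0 by rewrite psi0// normrN ger0_norm.
  by rewrite !mulr0 subrr sub0r.
- exact: continuous_subspaceT.
- split; first by move=> x _; have [] := df x.
  + by apply: cvg_at_right_filter; exact: cf.
  + by apply: cvg_at_left_filter; exact: cf.
- by move=> x _; rewrite derive1E; exact: derive_val.
- by apply: continuous_subspaceT; exact: cpsi.
- split; first by move=> x _; exact: (dpsi 0%N).
  + by apply: cvg_at_right_filter; exact: (cpsi 0%N).
  + by apply: cvg_at_left_filter; exact: (cpsi 0%N).
Qed.

Lemma h2_ball_derive (C : R) (F : nat -> R -> R) :
  (forall j (x : R), is_derive x 1 (F j) (F j.+1 x)) ->
  (forall j x, (j <= 2)%N -> `|F j x| <= C * (oneDsqr x)^-1) -> h2_ball C F.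
Proof.
move=> dF bF.
have cF j : continuous (F j).
  by apply: derivable_continuous => x; have [] := dF j x.
split; last by move=> j _ psi tpsi; exact: integration_by_parts_test.
move=> j j2; split; first exact: continuous_measurable_fun.
by move=> x; exact: bF.
Qed.

(** Over n + 1 equal steps the increments add up to at most L T^2/(n + 1). This avoids
    differentiating [E] at individual times. *)
Lemma eq_of_quadratic_increments (E : R -> R) (T L : R) : 0 < T ->
  (forall s t, 0 <= s -> s <= t -> t <= T -> `|E t - E s| <= L * (t - s) ^+ 2) ->
  E T = E 0.
Proof.
move=> T0 EL.
have step n k : (k <= n.+1)%N ->
    `|E (k%:R * (T / n.+1%:R)) - E 0| <= k%:R * (L * (T / n.+1%:R) ^+ 2).
  have h0 : 0 <= T / n.+1%:R by rewrite divr_ge0// ltW.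
  elim: k => [_|k ih kn]; first by rewrite !mul0r subrr normr0.
  set h := T / n.+1%:R in h0 ih *.
  have dk : (k%:R + 1) * h - k%:R * h = h by rewrite mulrDl mul1r addrAC subrr add0r.
  have kT : (k%:R + 1) * h <= T.
    by rewrite natr1 mulrCA ger_pMr// ler_pdivrMr ?ltr0n// mul1r ler_nat.
  have k0 : 0 <= k%:R * h by rewrite mulr_ge0.
  have kk : k%:R * h <= (k%:R + 1) * h by rewrite ler_wpM2r// lerDl.
  have := EL _ _ k0 kk kT; rewrite dk => Ek; have {}ih := ih (ltnW kn).
  rewrite -natr1 [leRHS]mulrDl mul1r -(subrKA (E (k%:R * h))).
  by apply: le_trans (ler_normD _ _) _; rewrite addrC lerD.
apply/eqP; rewrite -subr_eq0 -normr_eq0; apply/eqP/le_anti; rewrite normr_ge0 andbT.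
apply/ler_addgt0Pl => e e0; rewrite addr0.
have L0 : 0 <= L.
  have := EL 0 T (lexx _) (ltW T0) (lexx _); rewrite subr0 => /(le_trans (normr_ge0 _)).
  by rewrite pmulr_lge0// exprn_gt0.
have := archi_boundP (divr_ge0 (mulr_ge0 L0 (sqr_ge0 T)) (ltW e0)).
set n := Num.bound _ => nP.
have := step n n.+1 (leqnn _).
have n0 : n.+1%:R != 0 :> R by [].
have -> : n.+1%:R * (T / n.+1%:R) = T by field; rewrite addrC natr1.
have -> : n.+1%:R * (L * (T / n.+1%:R) ^+ 2) = L * T ^+ 2 / n.+1%:R.
  by field; rewrite addrC natr1.
move=> /le_trans; apply; rewrite ler_pdivrMr ?ltr0n// [leRHS]mulrC -ler_pdivrMr//.
by rewrite (le_trans (ltW nP))// ler_nat.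
Qed.

Lemma le_norm_Rintegral_itv (h : R -> R) (s t L : R) : s <= t -> 0 <= L ->
  mu.-integrable `]s, t] (EFin \o h) ->
  {ae mu, forall x, s < x -> x < t -> `|h x| <= L} ->
  `|\int[mu]_(x in `]s, t]) h x| <= L * (t - s).
Proof.
move=> st L0 hi hL.
have {}hi : mu.-integrable `]s, t[ (EFin \o h).
  by apply: integrableS hi => //; apply: subset_itvl; rewrite bnd_simp.
have mh := measurable_intR hi.
rewrite -Rintegral_itv_bndo_bndc// -lee_fin EFin_normr_Rintegral//.
apply: le_trans (le_abse_integral _ _ _) _ => //; first exact/measurable_EFinP.
apply: (@le_trans _ _ (L%:E * mu `]s, t[%classic)%E).
  apply: integral_le_bound => //; first exact/measurable_EFinP.
  apply: filterS hL; first exact: (ae_filter_ringOfSetsType mu).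
  by move=> x /= hx; rewrite in_itv/= => /andP[sx xt]; rewrite lee_fin hx.
rewrite lebesgue_measure_itv/= lte_fin; case: ifPn => st'; first by rewrite -EFinD -EFinM.
by rewrite mule0 lee_fin mulr_ge0// subr_ge0.
Qed.

(* What the argument uses of the real or imaginary part [w] of a solution with
   control [u]; [d] is the time derivative of the pairing with [F 0]. *)
Definition controlled_heat (T : R) (w : R -> R -> R) (u : R -> R) : Prop :=
  [/\ forall t, 0 <= t <= T -> measurable_fun setT (w t) /\
        mu.-integrable setT (EFin \o (fun x => w t x * (oneDsqr x)^-1)),
      measurable_fun setT u /\ (exists U, forall s, `|u s| <= U),
      forall C F, h2_ball C F ->
        exists M : R, forall t, 0 <= t <= T -> `|\int[mu]_x (w t x * F 0%N x)| <= M &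
      forall C F, h2_ball C F -> continuous (F 1%N) -> exists d : R -> R,
        [/\ mu.-integrable `[0, T] (EFin \o d),
            {ae mu, forall s, 0 < s < T ->
              d s = \int[mu]_x (w s x * F 2%N x) + 2 * u s * F 1%N 0} &
            forall t, 0 <= t <= T -> \int[mu]_x (w t x * F 0%N x) =
              \int[mu]_x (w 0 x * F 0%N x) + \int[mu]_(s in `[0, t]) d s]].

(* [Phi j r] is the j-th space derivative at time r of a solution of the
   backward heat equation. *)
Definition backward_heat_jet (T C : R) (Phi : nat -> R -> R -> R) : Prop :=
  [/\ forall j r (x : R), 0 <= r <= T -> is_derive x 1 (Phi j r) (Phi j.+1 r x),
      forall j r x, (j <= 6)%N -> 0 <= r <= T ->
        `|Phi j r x| <= C * (oneDsqr x)^-1,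
      forall j r s x, (j <= 2)%N -> 0 <= r <= T -> 0 <= s <= T ->
        `|Phi j s x - Phi j r x + (s - r) * Phi j.+2 r x| <=
        C * (s - r) ^+ 2 * (oneDsqr x)^-1 &
      measurable_fun `[0, T] (fun s => Phi 1%N s 0)].

Section dual_pairing.
Variables (T : R) (w : R -> R -> R) (u : R -> R).
Variables (C : R) (Phi : nat -> R -> R -> R).
Hypotheses (T0 : 0 < T) (wP : controlled_heat T w u).
Hypotheses (C0 : 0 < C) (PhiP : backward_heat_jet T C Phi).

Let pair (t : R) (f : R -> R) := \int[mu]_x (w t x * f x).

(** Orders up to 6 are controlled so that i = 4 is allowed: the pairing with [Phi 2] changes at a
    rate involving [Phi 4], which is estimated through its own 2-jet. *)
Let ball i r : (i <= 4)%N -> 0 <= r <= T -> h2_ball C (fun j => Phi (i + j)%N r).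
Proof.
move=> i4 rT; have [dP bP _ _] := PhiP; apply: h2_ball_derive => [j x|j x j2].
  by rewrite addnS; exact: dP.
by apply: bP => //; rewrite -[6%N]/(4 + 2)%N leq_add.
Qed.

Let cPhi j r : 0 <= r <= T -> continuous (Phi j r).
Proof.
by move=> rT; have [dP _ _ _] := PhiP; apply: derivable_continuous => x; have [] := dP j r x rT.
Qed.

Let pairB r s t : 0 <= r <= T -> 0 <= s <= T -> 0 <= t <= T ->
  pair t (Phi 0%N s) - pair t (Phi 0%N r) + (s - r) * pair t (Phi 2%N r) =
  \int[mu]_x (w t x * (Phi 0%N s x - Phi 0%N r x + (s - r) * Phi 2%N r x)).
Proof.
move=> rT sT tT; have [/(_ t tT)[mw iw] _ _ _] := wP; have [_ bP _ _] := PhiP.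
have ip j q : (j <= 6)%N -> 0 <= q <= T ->
    mu.-integrable setT (EFin \o (fun x => w t x * Phi j q x)).
  move=> j6 qT; apply: integrable_pairing iw => //.
    by apply: continuous_measurable_fun; exact: cPhi.
  by move=> x; exact: bP.
under [RHS]eq_Rintegral do rewrite mulrDr mulrBr mulrCA.
rewrite RintegralD//; [|by apply: integrableBR => //; exact: ip|
  by apply: integrableZR => //; exact: ip].
by rewrite RintegralB ?RintegralZl//; exact: ip.
Qed.

(** From s to t the pairing changes by <w(t) - w(s), Phi(t)> + <w(s), Phi(t) - Phi(s)>. In the first
    term the test function is frozen, so the equation of [w] gives the integral of <w, Phi_xx(t)>
    and a control term. The second is -(t - s) <w(s), Phi_xx(t)> up to second order, by the backward
    equation. The two Laplacian terms cancel up to O((t - s)^2), and so does the control term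
    against [g], which differs from it by evaluating the slope at the running time. *)
Lemma duality_pairing :
  \int[mu]_x (w T x * Phi 0%N T x) - \int[mu]_x (w 0 x * Phi 0%N 0 x) =
  \int[mu]_(s in `[0, T]) (2 * u s * Phi 1%N s 0).
Proof.
have [wP1 [mu_ [U uU]] wP3 wP4] := wP; have [dP bP tP mP] := PhiP.
have [K K0 HK] : exists2 K : R, 0 < K & forall C F, 0 < C -> h2_ball C F ->
    forall t, 0 <= t <= T -> `|pair t (F 0%N)| <= C * K.
  apply: (@uniform_h2_bound _ [set t | 0 <= t <= T]) => [t tT|t tT|]; [| |exact: wP3].
  - by have [] := wP1 t tT.
  - by have [] := wP1 t tT.
have U0 : 0 <= U := le_trans (normr_ge0 _) (uU 0).
have TT : 0 <= T <= T by rewrite (ltW T0) lexx.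
have T00 : 0 <= (0 : R) <= T by rewrite lexx (ltW T0).
pose c s := Phi 1%N s 0.
have cC j s : (j <= 6)%N -> 0 <= s <= T -> `|Phi j s 0| <= C.
  by move=> j6 sT; have := bP j s 0 j6 sT; rewrite /oneDsqr expr0n/= addr0 invr1 mulr1.
(* The fundamental theorem in time, with the test function frozen at time [r]. *)
have incr i r s t : (i <= 4)%N -> 0 <= r <= T -> 0 <= s -> s <= t -> t <= T ->
    exists d : R -> R, [/\ mu.-integrable `]s, t] (EFin \o d),
      {ae mu, forall x, 0 < x < T ->
        d x = pair x (Phi i.+2 r) + 2 * u x * Phi i.+1 r 0} &
      pair t (Phi i r) - pair s (Phi i r) = \int[mu]_(x in `]s, t]) d x].
  move=> i4 rT s0 st tT.
  have [|d [di dE dP']] := wP4 _ _ (ball i4 rT); first exact: cPhi.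
  exists d; split.
  - by apply: integrableS di => //; apply: subset_itv; rewrite bnd_simp.
  - by move: dE; rewrite addn1 addn2.
  - rewrite /pair; have := dP' t; have := dP' s.
    rewrite addn0 => -> ; last by rewrite s0 (le_trans st).
    move=> ->; last by rewrite tT (le_trans s0).
    rewrite opprD addrACA subrr add0r -(@Rintegral_itvB _ d (BLeft 0) (BRight t) s) ?bnd_simp//.
    by apply: integrableS di => //; apply: subset_itvl; rewrite bnd_simp.
have pb i r t : (i <= 4)%N -> 0 <= r <= T -> 0 <= t <= T -> `|pair t (Phi i r)| <= C * K.
  by move=> i4 rT tT; have := HK _ _ C0 (ball i4 rT) t tT; rewrite addn0.
have CK0 : 0 <= C * K by rewrite mulr_ge0 ?ltW.
pose Lp := C * K + 2 * U * C.
have Lp0 : 0 <= Lp by rewrite addr_ge0// !mulr_ge0// ltW.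
(* The rate of change is a pairing with [Phi 4] plus a control term; [Lp] adds their bounds. *)
have pLip r s t : 0 <= r <= T -> 0 <= s -> s <= t -> t <= T ->
    `|pair t (Phi 2%N r) - pair s (Phi 2%N r)| <= Lp * (t - s).
  move=> rT s0 st tT; have [//|d [di dE ->]] := @incr 2%N r s t _ rT s0 st tT.
  apply: le_norm_Rintegral_itv => //.
  apply: filterS dE; first exact: (ae_filter_ringOfSetsType mu).
  move=> x dE sx xt; have xT : 0 < x < T by rewrite (le_lt_trans s0)//= (lt_le_trans xt).
  have xT' : 0 <= x <= T by case/andP: xT => /ltW -> /ltW ->.
  rewrite dE//; apply: le_trans (ler_normD _ _) _; apply: lerD; first exact: pb.
  rewrite !normrM [`|2|]ger0_norm// -!mulrA ler_wpM2l// ler_pM//.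
  exact: cC.
pose Cc := C * (1 + T).
have Cc0 : 0 <= Cc by rewrite mulr_ge0 ?addr_ge0 ?ltW.
have cLip s t : 0 <= s -> s <= t -> t <= T -> `|c t - c s| <= Cc * (t - s).
  move=> s0 st tT.
  have sT : 0 <= s <= T by rewrite s0 (le_trans st).
  have tT' : 0 <= t <= T by rewrite tT (le_trans s0).
  (* Lipschitz continuity is read off the Taylor bound: the linear term costs C, and one factor of
     the quadratic term is replaced by T. *)
  have := @tP 1%N s t 0 isT sT tT'.
  have := @cC 3%N s isT sT.
  rewrite /oneDsqr expr0n/= addr0 invr1 mulr1 -/(c t) -/(c s) => h3 h1.
  rewrite -[X in `|X|](addrK ((t - s) * Phi 3%N s 0)).
  apply: le_trans (ler_normB _ _) _; rewrite normrM [`|t - s|]ger0_norm ?subr_ge0//.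
  have ts0 : 0 <= t - s by rewrite subr_ge0.
  have : (t - s) * `|Phi 3%N s 0| <= (t - s) * C by rewrite ler_wpM2l.
  have : C * (t - s) ^+ 2 <= C * (t - s) * T.
    by rewrite expr2 mulrA ler_wpM2l ?mulr_ge0 ?(ltW C0)//; lra.
  by rewrite /Cc; move: h1; nra.
clearbody Cc; pose g s := 2 * u s * c s.
have gi : mu.-integrable `[0, T] (EFin \o g).
  apply: (@le_integrableR _ _ _ _ _ _ (cst (2 * U * C))) => //.
  - apply: measurable_funM => //; apply: measurable_funM => //.
    exact: measurable_funTS.
  - move=> x; rewrite /= in_itv/= => xT.
    by rewrite !normrM [`|2|]ger0_norm// -!mulrA ler_wpM2l// ler_pM// cC.
  - apply: continuous_compact_integrable; first exact: segment_compact.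
    by apply: continuous_subspaceT => x; exact: cvg_cst.
pose E t := pair t (Phi 0%N t) - \int[mu]_(s in `[0, t]) g s.
suff : E T = E 0.
  rewrite /E set_itv1 Rintegral_set1 subr0 => ETE.
  by rewrite -/(pair T _) -/(pair 0 _) -ETE opprB addrCA subrr addr0.
apply: (@eq_of_quadratic_increments _ _ (Lp + 2 * U * Cc + C * K)) => // s t s0 st tT.
have sT : 0 <= s <= T by rewrite s0 (le_trans st).
have tT' : 0 <= t <= T by rewrite tT (le_trans s0).
have [//|d [di dE dP']] := @incr 0%N t s t _ tT' s0 st tT.
have gi' : mu.-integrable `]s, t] (EFin \o g).
  by apply: integrableS gi => //; apply: subset_itv; rewrite bnd_simp.
pose p := pair s (Phi 2%N t).
have pi' : mu.-integrable `]s, t] (EFin \o (cst p : R -> R)).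
  have : mu.-integrable `[s, t] (EFin \o (cst p : R -> R)).
    apply: continuous_compact_integrable; first exact: segment_compact.
    by apply: continuous_subspaceT => x; exact: cvg_cst.
  by apply: integrableS => //; apply: subset_itvr; rewrite bnd_simp.
have -> : E t - E s =
    \int[mu]_(x in `]s, t]) (d x - g x - p) -
    (pair s (Phi 0%N s) - pair s (Phi 0%N t) + (s - t) * p).
  rewrite !RintegralB//; last exact: integrableBR.
  rewrite -dP' Rintegral_cst//= lebesgue_measure_itv/= lte_fin.
  rewrite -(@Rintegral_itvB _ g (BLeft 0) (BRight t) s) ?bnd_simp//; last first.
    by apply: integrableS gi => //; apply: subset_itvl; rewrite bnd_simp.
  rewrite /E; move: st; rewrite le_eqVlt => /predU1P[->|st'].
    by rewrite ltxx/=; lra.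
  by rewrite st' -EFinD/=; lra.
apply: le_trans (ler_normB _ _) _; rewrite [leRHS]mulrDl; apply: lerD.
  rewrite expr2 mulrA; apply: le_norm_Rintegral_itv => //.
  - apply: mulr_ge0; last by rewrite subr_ge0.
    apply: addr_ge0 => //. apply: mulr_ge0 => //. exact: mulr_ge0.
  - by apply: integrableBR => //; exact: integrableBR.
  apply: filterS dE; first exact: (ae_filter_ringOfSetsType mu).
  move=> x dE sx xt; have xT : 0 < x < T by rewrite (le_lt_trans s0)//= (lt_le_trans xt).
  have xT' : 0 <= x <= T by case/andP: xT => /ltW -> /ltW ->.
  rewrite dE// /g -/(c t).
  have -> : pair x (Phi 2%N t) + 2 * u x * c t - 2 * u x * c x - p =
    (pair x (Phi 2%N t) - p) + 2 * u x * (c t - c x) by ring.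
  apply: le_trans (ler_normD _ _) _; rewrite [leRHS]mulrDl; apply: lerD.
    have := @pLip t s x tT' s0 (ltW sx) (le_trans (ltW xt) tT) => /le_trans; apply.
    by rewrite ler_wpM2l// lerD2r ltW.
  rewrite !normrM [`|2|]ger0_norm// -!mulrA ler_wpM2l//.
  apply: ler_pM => //.
  case/andP: xT => /ltW x0 _; have := @cLip x t x0 (ltW xt) tT => /le_trans; apply.
  by rewrite ler_wpM2l// lerB// ltW.
rewrite /p pairB//.
(* The uniform bound asks for a positive radius, here C (s - t)^2, so s = t is treated apart. *)
have [->|ts] := eqVneq s t.
  rewrite subrr expr0n/= mulr0; under eq_Rintegral do rewrite mul0r addr0 subrr mulr0.
  by rewrite /Rintegral integral0 normr0.
rewrite -sqrrN opprB mulrAC.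
apply: (HK _ (fun j x => Phi j s x - Phi j t x + (s - t) * Phi j.+2 t x)) => //.
  by rewrite mulr_gt0// exprn_even_gt0//= subr_eq0.
apply: h2_ball_derive; last by move=> j x j2; exact: tP.
move=> j x; have := dP j s x sT; have := dP j t x tT'; have := dP j.+2 t x tT'.
move=> d1 d2 d3.
have := is_deriveD (is_deriveB d3 d2) (is_deriveZ (s - t) d1).
by [].
Qed.

End dual_pairing.

End duality.

(** * Explicit solutions of the backward heat equation *)

Section mean_value.
Context {R : realType}.

Lemma mean_value_bound (f g : R -> R) (a b M : R) : a <= b ->
  (forall q, a <= q <= b -> is_derive q 1 f (g q)) ->
  (forall q, a <= q <= b -> `|g q| <= M) -> `|f b - f a| <= M * (b - a).
Proof.
move=> ab df gM.
have d1 q : q \in `]a, b[ -> is_derive q 1 f (g q).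
  by rewrite in_itv/= => /andP[/ltW aq /ltW qb]; apply: df; rewrite aq.
have c1 : {within `[a, b], continuous f}.
  apply: derivable_within_continuous => q; rewrite in_itv/= => qab.
  by have [] := df q qab.
have [q] := MVT_segment ab d1 c1; rewrite in_itv/= => qab ->.
by rewrite normrM (ger0_norm (x := b - a)) ?subr_ge0// ler_wpM2r ?subr_ge0// gM.
Qed.

(** The mean value bound is applied twice, to [g] and then to f(z) - z g(r); the factor 1/2 of
    Taylor's formula is given up. *)
Lemma taylor2_bound (f g h : R -> R) (T M r s : R) :
  (forall q, 0 <= q <= T -> is_derive q 1 f (g q)) ->
  (forall q, 0 <= q <= T -> is_derive q 1 g (h q)) ->
  (forall q, 0 <= q <= T -> `|h q| <= M) -> 0 <= r <= T -> 0 <= s <= T ->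
  `|f s - f r - (s - r) * g r| <= M * (s - r) ^+ 2.
Proof.
move=> df dg hM /andP[r0 rT] /andP[s0 sT].
have M0 : 0 <= M by apply: le_trans (hM r _) => //; rewrite r0.
have dk q : 0 <= q <= T -> is_derive q 1 (fun z => f z - z * g r) (g q - g r).
  move=> qT; have := df q qT => dfq.
  by apply: is_derive_eq; rewrite /GRing.scale /=; ring.
have -> : f s - f r - (s - r) * g r = (f s - s * g r) - (f r - r * g r) by ring.
have [rs|/ltW sr] := leP r s.
  have H := @mean_value_bound (fun z => f z - z * g r)
    (fun q => g q - g r) r s (M * (s - r)) rs.
  apply: (le_trans (H _ _)).
  - by move=> q /andP[rq qs]; apply: dk; rewrite (le_trans r0)//= (le_trans qs).
  - move=> q /andP[rq qs]; apply: (@le_trans _ _ (M * (q - r))).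
      apply: (@mean_value_bound g h) => // z /andP[rz zq].
        by apply: dg; rewrite (le_trans r0)//= (le_trans zq)// (le_trans qs).
      by apply: hM; rewrite (le_trans r0)//= (le_trans zq)// (le_trans qs).
    by rewrite ler_wpM2l// lerB.
  - by rewrite expr2 mulrA.
rewrite distrC; have H := @mean_value_bound (fun z => f z - z * g r)
    (fun q => g q - g r) s r (M * (r - s)) sr.
apply: (le_trans (H _ _)).
- by move=> q /andP[sq qr]; apply: dk; rewrite (le_trans s0)//= (le_trans qr).
- move=> q /andP[sq qr]; rewrite distrC; apply: (@le_trans _ _ (M * (r - q))).
    apply: (@mean_value_bound g h) => // z /andP[qz zr].
      by apply: dg; rewrite (le_trans s0) ?(le_trans sq)//= (le_trans zr).
    by apply: hM; rewrite (le_trans s0) ?(le_trans sq)//= (le_trans zr).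
  by rewrite ler_wpM2l// lerB.
- by rewrite -sqrrN opprB expr2 mulrA.
Qed.

End mean_value.

(** As a function of time this v satisfies v' = v^3/2, so time derivatives of the kernels stay
    polynomial in v; v is also the prefactor of the heat kernel up to a constant. *)
Definition inv_sqrt_time {R : realType} (tau r : R) : R := (Num.sqrt (tau - r))^-1.

(* Up to the factor [inv_sqrt_time tau r], the imaginary and real parts of the heat
   kernel of time [tau - r] centered at the complex point [y + i sigma]. *)
Definition sin_packet {R : realType} (sigma y tau x r : R) : R :=
  expR ((sigma ^+ 2 - (x - y) ^+ 2) * inv_sqrt_time tau r ^+ 2 / 4) *
  sin (sigma * (x - y) * inv_sqrt_time tau r ^+ 2 / 2).

Definition cos_packet {R : realType} (sigma y tau x r : R) : R :=
  expR ((sigma ^+ 2 - (x - y) ^+ 2) * inv_sqrt_time tau r ^+ 2 / 4) *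
  cos (sigma * (x - y) * inv_sqrt_time tau r ^+ 2 / 2).

Section gaussian_packets.
Context {R : realType}.
Variables (sigma y tau : R).

Local Notation v := (inv_sqrt_time tau).
Local Notation S := (sin_packet sigma y tau).
Local Notation C := (cos_packet sigma y tau).

(** These are the sums of the two packets multiplied by polynomials in x - y and v. Closure under
    both derivatives and decay bounds at every order follow by induction, without closed formulas
    for high derivatives. *)
Inductive packet : (R -> R -> R) -> Prop :=
| packet_sin : packet S
| packet_cos : packet C
| packetD F G : packet F -> packet G -> packet (fun x r => F x r + G x r)
| packetX F : packet F -> packet (fun x r => (x - y) * F x r)
| packetV F : packet F -> packet (fun x r => v r * F x r)
| packetZ c F : packet F -> packet (fun x r => c * F x r).

Lemma is_derive_inv_sqrt_time (r : R) : r < tau -> is_derive r 1 v (v r ^+ 3 / 2).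
Proof.
move=> rt; have tr0 : 0 < tau - r by rewrite subr_gt0.
have s0 : Num.sqrt (tau - r) != 0 by rewrite gt_eqF// sqrtr_gt0.
have d1 : is_derive r 1 (fun r => tau - r) (- 1).
  by apply: is_derive_eq; rewrite ?sub0r ?add0r; ring.
have d2 : is_derive r 1 (fun r => Num.sqrt (tau - r)) ((2 * Num.sqrt (tau - r))^-1 * (- 1)).
  have d3 : is_derive (tau - r) 1 Num.sqrt (2 * Num.sqrt (tau - r))^-1 by exact: is_derive1_sqrt.
  exact: (@is_derive1_comp _ Num.sqrt (fun r => tau - r) r _ _ d3 d1).
have := @is_deriveV _ (fun r => Num.sqrt (tau - r)) r _ 1 s0 d2.
rewrite /GRing.scale /= => d3; apply: is_derive_eq.
by rewrite /inv_sqrt_time; field; rewrite s0.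
Qed.

Let dpacket (A B : R -> R) (x a b : R) : is_derive x 1 A a -> is_derive x 1 B b ->
  is_derive x 1 (fun z => expR (A z) * sin (B z))
    (a * (expR (A x) * sin (B x)) + b * (expR (A x) * cos (B x))) /\
  is_derive x 1 (fun z => expR (A z) * cos (B z))
    (a * (expR (A x) * cos (B x)) - b * (expR (A x) * sin (B x))).
Proof.
move=> dA dB.
have dE : is_derive x 1 (fun z => expR (A z)) (expR (A x) * a).
  exact: (@is_derive1_comp _ expR A).
have dsin : is_derive x 1 (fun z => sin (B z)) (cos (B x) * b).
  exact: (@is_derive1_comp _ sin B).
have dcos : is_derive x 1 (fun z => cos (B z)) (- sin (B x) * b).
  exact: (@is_derive1_comp _ cos B).
by split; apply: is_derive_eq; rewrite /GRing.scale/=; ring.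
Qed.

Let dSCx (x r : R) :
  is_derive x 1 (S ^~ r)
    (- ((x - y) * v r ^+ 2 / 2) * S x r + sigma * v r ^+ 2 / 2 * C x r) /\
  is_derive x 1 (C ^~ r)
    (- ((x - y) * v r ^+ 2 / 2) * C x r - sigma * v r ^+ 2 / 2 * S x r).
Proof.
apply: dpacket; apply: is_derive_eq; rewrite /GRing.scale/=; by field.
Qed.

Let dSCr (x r : R) : r < tau ->
  is_derive r 1 (S x)
    ((sigma ^+ 2 - (x - y) ^+ 2) * v r ^+ 4 / 4 * S x r +
     sigma * (x - y) * v r ^+ 4 / 2 * C x r) /\
  is_derive r 1 (C x)
    ((sigma ^+ 2 - (x - y) ^+ 2) * v r ^+ 4 / 4 * C x r -
     sigma * (x - y) * v r ^+ 4 / 2 * S x r).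
Proof.
move=> /is_derive_inv_sqrt_time rt.
by apply: dpacket; apply: is_derive_eq; rewrite /GRing.scale/=; field.
Qed.

Let packet_eq F G : packet F -> (forall x r, F x r = G x r) -> packet G.
Proof.
by move=> pF FG; have -> : G = F by apply/funext => x; apply/funext.
Qed.

Let packetXV n F : packet F -> packet (fun x r => v r ^+ n * F x r).
Proof.
move=> pF; elim: n => [|n ih].
  by apply: (packet_eq (packetZ 1 pF)) => x r; rewrite expr0.
by apply: (packet_eq (packetV ih)) => x r; rewrite exprS mulrA.
Qed.

(* The mixed derivative is recorded so that space derivatives inherit the heat
   equation without appealing to a theorem on symmetry of second derivatives. *)
Lemma packet_derivatives F : packet F -> exists Fx Fr Fxr,
  [/\ packet Fx, packet Fr & packet Fxr] /\
  [/\ forall x r : R, is_derive x 1 (F ^~ r) (Fx x r),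
      forall x r : R, r < tau -> is_derive r 1 (F x) (Fr x r),
      forall x r : R, r < tau -> is_derive r 1 (Fx x) (Fxr x r) &
      forall x r : R, r < tau -> is_derive x 1 (Fr ^~ r) (Fxr x r)].
Proof.
have pS := packet_sin; have pC := packet_cos.
elim => {F} [||F G pF [Fx [Fr [Fxr [[p1 p2 p3] [h1 h2 h3 h4]]]]]
  pG [Gx [Gr [Gxr [[q1 q2 q3] [k1 k2 k3 k4]]]]]|
  F pF [Fx [Fr [Fxr [[p1 p2 p3] [h1 h2 h3 h4]]]]]|
  F pF [Fx [Fr [Fxr [[p1 p2 p3] [h1 h2 h3 h4]]]]]|
  c F pF [Fx [Fr [Fxr [[p1 p2 p3] [h1 h2 h3 h4]]]]]].
- exists (fun x r => - ((x - y) * v r ^+ 2 / 2) * S x r + sigma * v r ^+ 2 / 2 * C x r).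
  exists (fun x r => (sigma ^+ 2 - (x - y) ^+ 2) * v r ^+ 4 / 4 * S x r +
     sigma * (x - y) * v r ^+ 4 / 2 * C x r).
  exists (fun x r => - ((x - y) * v r ^+ 4 / 2) * S x r + sigma * v r ^+ 4 / 2 * C x r -
    (x - y) * v r ^+ 2 / 2 * ((sigma ^+ 2 - (x - y) ^+ 2) * v r ^+ 4 / 4 * S x r +
     sigma * (x - y) * v r ^+ 4 / 2 * C x r) +
    sigma * v r ^+ 2 / 2 * ((sigma ^+ 2 - (x - y) ^+ 2) * v r ^+ 4 / 4 * C x r -
     sigma * (x - y) * v r ^+ 4 / 2 * S x r)).
  split; [split|split].
  + have pK := (packetD (packetZ (- 2^-1) (packetX (packetXV 2 pS)))
      (packetZ (sigma / 2) (packetXV 2 pC))).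
    by apply: (packet_eq pK) => x r; field.
  + have pK := (packetD (packetD (packetZ (sigma ^+ 2 / 4) (packetXV 4 pS))
      (packetZ (- 4^-1) (packetX (packetX (packetXV 4 pS)))))
      (packetZ (sigma / 2) (packetX (packetXV 4 pC)))).
    by apply: (packet_eq pK) => x r; field.
  + have X1 := packetX (packetXV 4 pS); have X2 := packetXV 4 pC.
    have X3 := packetX (packetXV 6 pS); have X4 := packetX (packetX X3).
    have X5 := packetX (packetX (packetXV 6 pC)); have X6 := packetXV 6 pC.
    have pK := (packetD (packetD (packetD (packetZ (- 2^-1) X1)
      (packetZ (sigma / 2) X2)) (packetD (packetZ (- (sigma ^+ 2 / 8 * 3)) X3)
      (packetZ (8^-1) X4))) (packetD (packetZ (- (sigma / 8 * 3)) X5)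
      (packetZ (sigma ^+ 3 / 8) X6))).
    by apply: (packet_eq pK) => x r; field.
  + by move=> x r; exact: (dSCx x r).1.
  + by move=> x r rt; exact: (dSCr x rt).1.
  + move=> x r rt; have rt' := is_derive_inv_sqrt_time rt; have [d1 d2] := dSCr x rt.
    by apply: is_derive_eq; rewrite /GRing.scale/=; field.
  + move=> x r rt; have [d1 d2] := dSCx x r.
    by apply: is_derive_eq; rewrite /GRing.scale/=; field.
- exists (fun x r => - ((x - y) * v r ^+ 2 / 2) * C x r - sigma * v r ^+ 2 / 2 * S x r).
  exists (fun x r => (sigma ^+ 2 - (x - y) ^+ 2) * v r ^+ 4 / 4 * C x r -
     sigma * (x - y) * v r ^+ 4 / 2 * S x r).
  exists (fun x r => - ((x - y) * v r ^+ 4 / 2) * C x r - sigma * v r ^+ 4 / 2 * S x r -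
    (x - y) * v r ^+ 2 / 2 * ((sigma ^+ 2 - (x - y) ^+ 2) * v r ^+ 4 / 4 * C x r -
     sigma * (x - y) * v r ^+ 4 / 2 * S x r) -
    sigma * v r ^+ 2 / 2 * ((sigma ^+ 2 - (x - y) ^+ 2) * v r ^+ 4 / 4 * S x r +
     sigma * (x - y) * v r ^+ 4 / 2 * C x r)).
  split; [split|split].
  + have pK := (packetD (packetZ (- 2^-1) (packetX (packetXV 2 pC)))
      (packetZ (- (sigma / 2)) (packetXV 2 pS))).
    by apply: (packet_eq pK) => x r; field.
  + have pK := (packetD (packetD (packetZ (sigma ^+ 2 / 4) (packetXV 4 pC))
      (packetZ (- 4^-1) (packetX (packetX (packetXV 4 pC)))))
      (packetZ (- (sigma / 2)) (packetX (packetXV 4 pS)))).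
    by apply: (packet_eq pK) => x r; field.
  + have X1 := packetX (packetXV 4 pC); have X2 := packetXV 4 pS.
    have X3 := packetX (packetXV 6 pC); have X4 := packetX (packetX X3).
    have X5 := packetX (packetX (packetXV 6 pS)); have X6 := packetXV 6 pS.
    have pK := (packetD (packetD (packetD (packetZ (- 2^-1) X1)
      (packetZ (- (sigma / 2)) X2)) (packetD (packetZ (- (sigma ^+ 2 / 8 * 3)) X3)
      (packetZ (8^-1) X4))) (packetD (packetZ (sigma / 8 * 3) X5)
      (packetZ (- (sigma ^+ 3 / 8)) X6))).
    by apply: (packet_eq pK) => x r; field.
  + by move=> x r; exact: (dSCx x r).2.
  + by move=> x r rt; exact: (dSCr x rt).2.
  + move=> x r rt; have rt' := is_derive_inv_sqrt_time rt; have [d1 d2] := dSCr x rt.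
    by apply: is_derive_eq; rewrite /GRing.scale/=; field.
  + move=> x r rt; have [d1 d2] := dSCx x r.
    by apply: is_derive_eq; rewrite /GRing.scale/=; field.
- exists (fun x r => Fx x r + Gx x r), (fun x r => Fr x r + Gr x r),
    (fun x r => Fxr x r + Gxr x r).
  split; [split; exact: packetD|split].
  + by move=> x r; have := h1 x r; have := k1 x r => d1 d2; exact: is_deriveD.
  + by move=> x r rt; exact: is_deriveD (h2 x r rt) (k2 x r rt).
  + by move=> x r rt; exact: is_deriveD (h3 x r rt) (k3 x r rt).
  + by move=> x r rt; exact: is_deriveD (h4 x r rt) (k4 x r rt).
- exists (fun x r => F x r + (x - y) * Fx x r), (fun x r => (x - y) * Fr x r),
    (fun x r => Fr x r + (x - y) * Fxr x r).
  split; [split|split].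
  + by apply: packetD => //; exact: packetX.
  + exact: packetX.
  + by apply: packetD => //; exact: packetX.
  + by move=> x r; have d1 := h1 x r; apply: is_derive_eq; rewrite /GRing.scale/=; ring.
  + by move=> x r rt; have d1 := h2 x r rt; apply: is_derive_eq; rewrite /GRing.scale/=; ring.
  + move=> x r rt; have d1 := h2 x r rt; have d2 := h3 x r rt.
    by apply: is_derive_eq; rewrite /GRing.scale/=; ring.
  + by move=> x r rt; have d1 := h4 x r rt; apply: is_derive_eq; rewrite /GRing.scale/=; ring.
- exists (fun x r => v r * Fx x r), (fun x r => 2^-1 * (v r ^+ 3 * F x r) + v r * Fr x r),
    (fun x r => 2^-1 * (v r ^+ 3 * Fx x r) + v r * Fxr x r).
  split; [split|split].
  + exact: packetV.
  + by apply: packetD; [apply: packetZ; exact: packetXV|exact: packetV].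
  + by apply: packetD; [apply: packetZ; exact: packetXV|exact: packetV].
  + by move=> x r; have d1 := h1 x r; apply: is_derive_eq; rewrite /GRing.scale/=; ring.
  + move=> x r rt; have d1 := h2 x r rt; have rt' := is_derive_inv_sqrt_time rt.
    by apply: is_derive_eq; rewrite /GRing.scale/=; field.
  + move=> x r rt; have d1 := h3 x r rt; have rt' := is_derive_inv_sqrt_time rt.
    by apply: is_derive_eq; rewrite /GRing.scale/=; field.
  + move=> x r rt; have d1 := h4 x r rt; have d2 := h1 x r.
    by apply: is_derive_eq; rewrite /GRing.scale/=; ring.
- exists (fun x r => c * Fx x r), (fun x r => c * Fr x r), (fun x r => c * Fxr x r).
  split; [split; exact: packetZ|split].
  + by move=> x r; have d1 := h1 x r; exact: is_deriveZ.
  + by move=> x r rt; have d1 := h2 x r rt; exact: is_deriveZ.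
  + by move=> x r rt; have d1 := h3 x r rt; exact: is_deriveZ.
  + by move=> x r rt; have d1 := h4 x r rt; exact: is_deriveZ.
Qed.

Lemma inv_sqrt_time_gt0 r : r < tau -> 0 < v r.
Proof. by move=> rt; rewrite invr_gt0 sqrtr_gt0 subr_gt0. Qed.

Lemma le_inv_sqrt_time r s : r <= s -> s < tau -> v r <= v s.
Proof.
move=> rs st; rewrite lef_pV2 ?posrE ?sqrtr_gt0 ?subr_gt0//; last exact: le_lt_trans st.
by rewrite ler_wsqrtr// lerD2l lerN2.
Qed.

(** As v increases with time, the growth in sigma is worst at time T and the Gaussian decay slowest
    at time 0. *)
Let bpacket (T x r : R) : T < tau -> 0 <= r <= T ->
  expR ((sigma ^+ 2 - (x - y) ^+ 2) * v r ^+ 2 / 4) <=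
  expR (sigma ^+ 2 * v T ^+ 2 / 4) * expR (- (v 0 ^+ 2 / 4 * (x - y) ^+ 2)).
Proof.
move=> Tt /andP[r0 rT]; rewrite -expRD ler_expR.
have rt : r < tau by exact: le_lt_trans Tt.
have v0 : 0 < v 0 by apply: inv_sqrt_time_gt0; exact: le_lt_trans rt.
have v0r := le_inv_sqrt_time r0 rt; have vrT := le_inv_sqrt_time rT Tt.
have h1 : v r ^+ 2 <= v T ^+ 2 by rewrite ler_sqr// nnegrE (le_trans (ltW v0))// (le_trans v0r).
have h2 : v 0 ^+ 2 <= v r ^+ 2 by rewrite ler_sqr// nnegrE ?(ltW v0)// (le_trans (ltW v0)).
have := ler_wpM2l (sqr_ge0 sigma) h1; have := ler_wpM2l (sqr_ge0 (x - y)) h2.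
by lra.
Qed.

(** A factor x - y costs one power of 1 + (x - y)^2, which exceeds |x - y|; a factor v costs the
    constant v(T). *)
Lemma packet_bound T F : T < tau -> packet F -> exists (B : R) (k : nat), 0 <= B /\
  forall x r, 0 <= r <= T ->
    `|F x r| <= B * (oneDsqr (x - y) ^+ k * expR (- (v 0 ^+ 2 / 4 * (x - y) ^+ 2))).
Proof.
move=> Tt.
have X1 x : 1 <= oneDsqr (x - y) := oneDsqr_ge1 _.
have E0 x := expR_ge0 (- (v 0 ^+ 2 / 4 * (x - y) ^+ 2)).
elim => {F} [||F G _ [B [k [B0 hB]]] _ [D [m [D0 hD]]]|
  F _ [B [k [B0 hB]]]|F _ [B [k [B0 hB]]]|c F _ [B [k [B0 hB]]]].
- exists (expR (sigma ^+ 2 * v T ^+ 2 / 4)), 0%N; split; first exact: expR_ge0.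
  move=> x r rT; rewrite expr0 mul1r; apply: le_trans (bpacket _ Tt rT).
  rewrite normrM ger0_norm ?expR_ge0// ler_piMr ?expR_ge0//.
  by rewrite ler_norml sin_geN1 sin_le1.
- exists (expR (sigma ^+ 2 * v T ^+ 2 / 4)), 0%N; split; first exact: expR_ge0.
  move=> x r rT; rewrite expr0 mul1r; apply: le_trans (bpacket _ Tt rT).
  rewrite normrM ger0_norm ?expR_ge0// ler_piMr ?expR_ge0//.
  by rewrite ler_norml cos_geN1 cos_le1.
- exists (B + D), (k + m)%N; split; first exact: addr_ge0.
  move=> x r rT; apply: le_trans (ler_normD _ _) _; rewrite mulrDl; apply: lerD.
    apply: le_trans (hB x r rT) _; rewrite ler_wpM2l// ler_wpM2r//.
    by rewrite ler_weXn2l// leq_addr.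
  apply: le_trans (hD x r rT) _; rewrite ler_wpM2l// ler_wpM2r//.
  by rewrite ler_weXn2l// leq_addl.
- exists B, k.+1; split=> // x r rT; rewrite normrM exprS -mulrA mulrCA.
  apply: ler_pM => //; last exact: hB.
  rewrite ler_norml /oneDsqr; have := sqr_ge0 (x - y - 1); have := sqr_ge0 (x - y + 1).
  by rewrite !expr2 => h1 h2; apply/andP; split; nra.
- exists (v T * B), k; split.
    have [T0|T0] := leP 0 T; first by rewrite mulr_ge0// ltW// inv_sqrt_time_gt0.
    by rewrite mulr_ge0// ltW// inv_sqrt_time_gt0.
  move=> x r rT; rewrite normrM -mulrA; apply: ler_pM => //; last exact: hB.
  case/andP: rT => r0 rT; rewrite gtr0_norm; last first.
    by apply: inv_sqrt_time_gt0; exact: le_lt_trans Tt.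
  exact: le_inv_sqrt_time.
- exists (`|c| * B), k; split; first by rewrite mulr_ge0.
  by move=> x r rT; rewrite normrM -[leRHS]mulrA ler_wpM2l// hB.
Qed.

(** The factor 1 + x^2 is absorbed by 1 + x^2 <= 2 (1 + y^2) (1 + (x - y)^2). For X = 1 + (x - y)^2,
    a single term of the exponential series then bounds X^(k+1) by (k+1)! e^(c X) / c^(k+1). *)
Lemma oneDsqr_gaussian_decay (c : R) k : 0 < c -> exists2 D : R, 0 <= D &
  forall x, oneDsqr (x - y) ^+ k * expR (- (c * (x - y) ^+ 2)) <= D * (oneDsqr x)^-1.
Proof.
move=> c0; exists (2 * oneDsqr y * (k.+1`!%:R * expR c / c ^+ k.+1)).
  have := oneDsqr_gt0 y => y0.
  by rewrite !mulr_ge0 ?invr_ge0 ?exprn_ge0 ?expR_ge0 ?(ltW y0) ?(ltW c0).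
move=> x; rewrite ler_pdivlMr ?oneDsqr_gt0//.
have x1 : oneDsqr x <= 2 * oneDsqr y * oneDsqr (x - y).
  rewrite /oneDsqr; have := sqr_ge0 (x - y - y); have := mulr_ge0 (sqr_ge0 y) (sqr_ge0 (x - y)).
  by rewrite !expr2; nra.
have X0 := oneDsqr_gt0 (x - y).
apply: le_trans (ler_wpM2l _ x1) _; first by rewrite mulr_ge0 ?expR_ge0 ?exprn_ge0 ?ltW.
have -> : oneDsqr (x - y) ^+ k * expR (- (c * (x - y) ^+ 2)) *
    (2 * oneDsqr y * oneDsqr (x - y)) =
  2 * oneDsqr y * (oneDsqr (x - y) ^+ k.+1 * expR (- (c * (x - y) ^+ 2))).
  by rewrite (exprS _ k); ring.
rewrite ler_wpM2l ?mulr_ge0 ?(ltW (oneDsqr_gt0 _))//.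
have := @exprn_div_fact_le _ (c * oneDsqr (x - y)) k.+1 (mulr_ge0 (ltW c0) (ltW X0)).
rewrite ler_pdivrMr ?ltr0n ?fact_gt0// exprMn => h.
rewrite expRN ler_pdivrMr ?expR_gt0// mulrAC ler_pdivlMr ?exprn_gt0// mulrC; apply: le_trans h _.
have -> : c * oneDsqr (x - y) = c + c * (x - y) ^+ 2 by rewrite mulrDr mulr1. 
by rewrite expRD -[leRHS]mulrA [leRHS]mulrC.
Qed.

Lemma packet_decay T F : 0 <= T -> T < tau -> packet F -> exists2 B : R, 0 <= B &
  forall x r, 0 <= r <= T -> `|F x r| <= B * (oneDsqr x)^-1.
Proof.
move=> T0 Tt /(packet_bound Tt)[B [k [B0 hB]]].
have v0 : 0 < v 0 by apply: inv_sqrt_time_gt0; exact: le_lt_trans Tt.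
have c0 : 0 < v 0 ^+ 2 / 4 by rewrite divr_gt0// exprn_gt0.
have [D D0 hD] := oneDsqr_gaussian_decay k c0.
exists (B * D); first exact: mulr_ge0.
move=> x r rT; apply: le_trans (hB x r rT) _.
by rewrite -[leRHS]mulrA ler_wpM2l.
Qed.

(** The equation passes to space derivatives because the mixed derivative of [P j] is both the time
    derivative of [P j.+1] and the space derivative of - [P j.+2]. The Taylor remainder for j <= 2
    involves two time derivatives, hence space order j + 4 <= 6, and [M] collects the seven
    bounds. *)
Lemma packet_backward_heat T F : 0 <= T -> T < tau -> packet F ->
  (forall x r : R, r < tau -> is_derive r 1 (F x) (- derive1n 2 (F ^~ r) x)) ->
  exists2 C : R, 0 < C &
    backward_heat_jet T C (fun j r x => derive1n j (F ^~ r) x).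
Proof.
move=> T0 Tt pF hF.
pose P j x r := derive1n j (F ^~ r) x.
have pP j : packet (P j).
  elim: j => [|j ih]; first exact: pF.
  have [Fx [_ [_ [[px _ _] [dx _ _ _]]]]] := packet_derivatives ih.
  apply: (packet_eq px) => x r.
  by rewrite /P derive1nS derive1E (_ : derive1n j _ = (P j) ^~ r)// derive_val.
have dP j (x r : R) : is_derive x 1 ((P j) ^~ r) (P j.+1 x r).
  have [Fx [_ [_ [_ [dx _ _ _]]]]] := packet_derivatives (pP j).
  have := dx x r => dxr; apply: is_derive_eq.
  by rewrite /P derive1nS derive1E (_ : derive1n j _ = (P j) ^~ r)// derive_val.
have rP j : forall x r : R, r < tau -> is_derive r 1 (P j x) (- P j.+2 x r).
  elim: j => [|j ih] x r rt; first exact: hF.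
  have [Fx [Fr [Fxr [_ [d1 d2 d3 d4]]]]] := packet_derivatives (pP j).
  have FxE : Fx = P j.+1.
    apply/funext => z; apply/funext => q.
    have := d1 z q => h; rewrite -(@derive_val _ _ _ _ _ _ _ h).
    by have := dP j z q => h'; rewrite derive_val.
  have FrE z : Fr z r = - P j.+2 z r.
    have := d2 z r rt => h; rewrite -(@derive_val _ _ _ _ _ _ _ h).
    by have := ih z r rt => h'; rewrite derive_val.
  have := d3 x r rt; rewrite FxE; suff -> : Fxr x r = - P j.+3 x r by [].
  have := d4 x r rt => h; rewrite -(@derive_val _ _ _ _ _ _ _ h).
  have -> : Fr ^~ r = (fun z => - P j.+2 z r) by apply/funext.
  by have := dP j.+2 x r => h'; rewrite derive_val.
have /choice[B hB] j : exists B : R, 0 <= B /\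
    forall x r, 0 <= r <= T -> `|P j x r| <= B * (oneDsqr x)^-1.
  by have [B B0 hB] := packet_decay T0 Tt (pP j); exists B.
pose M : R := 1 + \sum_(j < 7) B j.
have BC j : (j < 7)%N -> B j <= M.
  move=> j7; rewrite /M (bigD1 (Ordinal j7))//= addrCA lerDl addr_ge0// sumr_ge0//.
  by move=> i _; have [] := hB i.
have M0 : 0 < M by rewrite ltr_pwDl// sumr_ge0// => i _; have [] := hB i.
exists M; [exact: M0|split].
- by move=> j r x _; exact: dP.
- move=> j r x j6 rT; apply: le_trans ((hB j).2 x r rT) _.
  by rewrite ler_wpM2r ?oneDsqrV_ge0// BC.
- move=> j r s x j2 rT sT; rewrite mulrAC.
  have -> : P j x s - P j x r + (s - r) * P j.+2 x r =
    P j x s - P j x r - (s - r) * (- P j.+2 x r) by ring.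
  have rt q : 0 <= q <= T -> q < tau by move=> /andP[_ qT]; exact: le_lt_trans Tt.
  apply: (@taylor2_bound _ (P j x) (fun q => - P j.+2 x q) (P j.+4 x) T) => //.
  + by move=> q qT; apply: rP; exact: rt.
  + move=> q qT; have := rP j.+2 x q (rt q qT) => d.
    by apply: is_derive_eq; rewrite opprK.
  + move=> q qT; apply: le_trans ((hB j.+4).2 x q qT) _.
    by rewrite ler_wpM2r ?oneDsqrV_ge0// BC// !ltnS.
- apply: subspace_continuous_measurable_fun => //.
  apply: derivable_within_continuous => q; rewrite in_itv/= => /andP[_ qT].
  by have [] := rP 1%N 0 q (le_lt_trans qT Tt).
Qed.

Let heat_jet (T : R) (G Gx Gxx : R -> R -> R) : 0 <= T -> T < tau -> packet G ->
  (forall x r : R, is_derive x 1 (G ^~ r) (Gx x r)) ->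
  (forall x r : R, is_derive x 1 (Gx ^~ r) (Gxx x r)) ->
  (forall x r : R, r < tau -> is_derive r 1 (G x) (- Gxx x r)) ->
  exists M Phi, [/\ 0 < M, backward_heat_jet T M Phi,
    forall r x, Phi 0%N r x = G x r & forall r x, Phi 1%N r x = Gx x r].
Proof.
move=> T0 Tt pG dG dGx dGr.
have d1 r x : derive1n 1 (G ^~ r) x = Gx x r.
  by rewrite derive1n1 derive1E; have := dG x r => h; rewrite derive_val.
have [|M M0 hM] := packet_backward_heat T0 Tt pG.
  move=> x r rt; have -> : derive1n 2 (G ^~ r) x = Gxx x r.
    rewrite derive1nS derive1E (_ : derive1n 1 _ = Gx ^~ r); last exact/funext.
    by have := dGx x r => h; rewrite derive_val.
  exact: dGr.
by exists M, (fun j r x => derive1n j (G ^~ r) x); split.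
Qed.

(** The slope [Phi 1] is made explicit because its value at 0 multiplies the control. *)
Lemma sin_packet_jet (T : R) : 0 <= T -> T < tau ->
  exists M Phi, [/\ 0 < M, backward_heat_jet T M Phi,
    forall r x, Phi 0%N r x = v r * S x r &
    forall r x, Phi 1%N r x = v r * (- ((x - y) * v r ^+ 2 / 2) * S x r +
      sigma * v r ^+ 2 / 2 * C x r)].
Proof.
move=> T0 Tt.
pose Gx x r := v r * (- ((x - y) * v r ^+ 2 / 2) * S x r +
  sigma * v r ^+ 2 / 2 * C x r).
pose Gxx x r := v r * (((x - y) ^+ 2 * v r ^+ 4 / 4 - sigma ^+ 2 * v r ^+ 4 / 4 -
  v r ^+ 2 / 2) * S x r - (x - y) * sigma * v r ^+ 4 / 2 * C x r).
have pG := packetV packet_sin.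
have dG (x r : R) : is_derive x 1 (fun z => v r * S z r) (Gx x r).
  by have [d1 d2] := dSCx x r; apply: is_derive_eq.
have dGx (x r : R) : is_derive x 1 (Gx ^~ r) (Gxx x r).
  have [d1 d2] := dSCx x r; apply: is_derive_eq.
  by rewrite /Gxx /GRing.scale/=; field.
have dGr (x r : R) : r < tau -> is_derive r 1 (fun q => v q * S x q) (- Gxx x r).
  move=> rt; have rt' := is_derive_inv_sqrt_time rt; have [d1 d2] := dSCr x rt.
  by apply: is_derive_eq; rewrite /Gxx /GRing.scale/=; field.
exact: heat_jet T0 Tt pG dG dGx dGr.
Qed.

Lemma cos_packet_jet (T : R) : 0 <= T -> T < tau ->
  exists M Phi, [/\ 0 < M, backward_heat_jet T M Phi &
    forall r x, Phi 0%N r x = v r * C x r].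
Proof.
move=> T0 Tt.
suff [M [Phi [M0 J Phi0 _]]] : exists M Phi, [/\ 0 < M, backward_heat_jet T M Phi,
    forall r x, Phi 0%N r x = v r * C x r &
    forall r x, Phi 1%N r x = v r * (- ((x - y) * v r ^+ 2 / 2) * C x r -
      sigma * v r ^+ 2 / 2 * S x r)] by exists M, Phi.
pose Gx x r := v r * (- ((x - y) * v r ^+ 2 / 2) * C x r -
  sigma * v r ^+ 2 / 2 * S x r).
pose Gxx x r := v r * (((x - y) ^+ 2 * v r ^+ 4 / 4 - sigma ^+ 2 * v r ^+ 4 / 4 -
  v r ^+ 2 / 2) * C x r + (x - y) * sigma * v r ^+ 4 / 2 * S x r).
have pG := packetV packet_cos.
have dG (x r : R) : is_derive x 1 (fun z => v r * C z r) (Gx x r).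
  by have [d1 d2] := dSCx x r; apply: is_derive_eq.
have dGx (x r : R) : is_derive x 1 (Gx ^~ r) (Gxx x r).
  have [d1 d2] := dSCx x r; apply: is_derive_eq.
  by rewrite /Gxx /GRing.scale/=; field.
have dGr (x r : R) : r < tau -> is_derive r 1 (fun q => v q * C x q) (- Gxx x r).
  move=> rt; have rt' := is_derive_inv_sqrt_time rt; have [d1 d2] := dSCr x rt.
  by apply: is_derive_eq; rewrite /Gxx /GRing.scale/=; field.
exact: heat_jet T0 Tt pG dG dGx dGr.
Qed.

End gaussian_packets.

(** * Vanishing of the control and of the initial state *)

Section gaussian_transform.
Context {R : realType}.
Notation mu := (@lebesgue_measure R).
Variables (f : R -> R) (y lambda : R).
Hypothesis mf : measurable_fun setT f.
Hypothesis fi : mu.-integrable setT (EFin \o (fun x => f x * (oneDsqr x)^-1)).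
Hypothesis lambda0 : 0 < lambda.
Hypothesis f_gauss : forall c, 0 < c < lambda ->
  \int[mu]_x (f x * expR (- (c * (x - y) ^+ 2))) = 0.

Let m (k : nat) (c : R) := \int[mu]_x (f x * ((x - y) ^+ 2) ^+ k * expR (- (c * (x - y) ^+ 2))).

Let mX : measurable_fun setT (fun x : R => (x - y) ^+ 2).
Proof. by apply: measurable_funX; exact: measurable_funB. Qed.

Let mgauss (c : R) : measurable_fun setT (fun x : R => expR (- (c * (x - y) ^+ 2))).
Proof.
apply: measurableT_comp => //; apply: measurableT_comp => //.
exact: measurable_funM.
Qed.

Let mint (h : R -> R) k (c : R) : measurable_fun setT h ->
  measurable_fun setT (fun x : R => h x * ((x - y) ^+ 2) ^+ k * expR (- (c * (x - y) ^+ 2))).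
Proof.
move=> mh; apply: measurable_funM; last exact: mgauss.
by apply: measurable_funM => //; exact: measurable_funX.
Qed.

Let mnf : measurable_fun setT (fun x => `|f x|).
Proof. exact: measurableT_comp. Qed.

Lemma integrable_gaussian_moment k (c : R) : 0 < c ->
  mu.-integrable setT
    (EFin \o (fun x => `|f x| * ((x - y) ^+ 2) ^+ k * expR (- (c * (x - y) ^+ 2)))).
Proof.
move=> c0; have [D D0 hD] := @oneDsqr_gaussian_decay _ y c k c0.
have := integrableZR D measurableT (integrable_norm_decay fi).
apply: le_integrableR => //; first exact: mint.
move=> x _; rewrite -mulrA normrM normr_id [leRHS]mulrCA ler_wpM2l//.
have X0 := sqr_ge0 (x - y).
rewrite ger0_norm; last by rewrite mulr_ge0 ?expR_ge0//; exact: exprn_ge0.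
apply: le_trans (hD x); rewrite ler_wpM2r ?expR_ge0//.
by rewrite lerXn2r ?nnegrE ?(ltW (oneDsqr_gt0 _))// /oneDsqr lerDr.
Qed.

Let igauss' k (c : R) : 0 < c ->
  mu.-integrable setT (EFin \o (fun x => f x * ((x - y) ^+ 2) ^+ k * expR (- (c * (x - y) ^+ 2)))).
Proof.
move=> c0; apply: le_integrableR (integrable_gaussian_moment k c0) => //; first exact: mint.
move=> x _; rewrite !normrM (ger0_norm (expR_ge0 _)) [`|_ ^+ k|]ger0_norm//.
by rewrite exprn_ge0// sqr_ge0.
Qed.

Lemma integrable_gaussian (c : R) : 0 < c ->
  mu.-integrable setT (EFin \o (fun x => f x * expR (- (c * (x - y) ^+ 2)))).
Proof.
move=> /(igauss' 0); apply: eq_integrable => // x _.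
by rewrite /= expr0 mulr1.
Qed.

(** Each moment is, up to sign, the derivative in c of the previous one, which vanishes near c.
    Differentiation under the integral is dominated on ]c/2, lambda[ by means of the Gaussian of
    rate c/2. *)
Let moments k c : 0 < c < lambda -> m k c = 0.
Proof.
elim: k c => [c cl|k ih c /andP[c0 cl]].
  by rewrite -(f_gauss cl); apply: eq_Rintegral => x _; rewrite expr0 mulr1.
pose F (c x : R) := f x * ((x - y) ^+ 2) ^+ k * expR (- (c * (x - y) ^+ 2)).
have dF (a x : R) : is_derive a 1 (F ^~ x)
    (- (f x * ((x - y) ^+ 2) ^+ k.+1 * expR (- (a * (x - y) ^+ 2)))).
  have d1 : is_derive a 1 (fun a => - (a * (x - y) ^+ 2)) (- (x - y) ^+ 2).
    by apply: is_derive_eq; rewrite /GRing.scale/=; ring.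
  have d2 := @is_derive1_comp _ expR _ _ _ _ (is_derive_expR _) d1.
  have : is_derive a 1 (F ^~ x) (f x * ((x - y) ^+ 2) ^+ k *
      (expR (- (a * (x - y) ^+ 2)) * - (x - y) ^+ 2)) by exact: is_deriveZ.
  by move=> h; apply: is_derive_eq; rewrite (exprS _ k); ring.
pose G x := `|f x| * ((x - y) ^+ 2) ^+ k.+1 * expR (- (c / 2 * (x - y) ^+ 2)).
have c20 : 0 < c / 2 by lra.
have d1F (a x : R) : partial1of2 F a x =
    - (f x * ((x - y) ^+ 2) ^+ k.+1 * expR (- (a * (x - y) ^+ 2))).
  by rewrite partial1of2E; have := dF a x => h; rewrite derive_val.
pose I : set R := `]c / 2, lambda[%classic.
have Ic : I c by rewrite /I/= in_itv/= cl andbT; lra.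
have intF z : I z -> mu.-integrable setT (EFin \o F z).
  by rewrite /I/= in_itv/= => /andP[cz _]; apply: igauss'; exact: lt_trans cz.
have derF z x : I z -> setT x -> derivable (F ^~ x) z 1.
  by move=> _ _; have [] := dF z x.
have G0 x : 0 <= G x.
  by rewrite !mulr_ge0 ?expR_ge0//; apply: exprn_ge0; exact: sqr_ge0.
have Gub z x : I z -> setT x -> `|partial1of2 F z x| <= G x.
  rewrite /I/= in_itv/= => /andP[cz _] _; rewrite d1F normrN !normrM.
  rewrite (ger0_norm (expR_ge0 _)) [`|_ ^+ k.+1|]ger0_norm; last first.
    by apply: exprn_ge0; exact: sqr_ge0.
  rewrite ler_wpM2l//.
    by rewrite mulr_ge0//; apply: exprn_ge0; exact: sqr_ge0.
  by rewrite ler_expR lerN2 ler_wpM2r ?sqr_ge0// ltW.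
have := differentiation_under_integral measurableT Ic intF derF G0
  (integrable_gaussian_moment k.+1 c20) Gub.
have -> : derive1 (fun z => \int[mu]_x F z x) c = 0.
  rewrite derive1E (near_eq_derive (g := cst 0)) ?derive_cst//.
  have : \forall z \near c, z \in `]0, lambda[.
    by apply: near_in_itvoo; rewrite in_itv/= c0.
  by apply: filterS => z; rewrite in_itv/= => /ih.
under eq_Rintegral do rewrite d1F -mulN1r.
rewrite RintegralZl//; last exact: igauss'.
by rewrite mulN1r => /esym/eqP; rewrite oppr_eq0 => /eqP.
Qed.

(* Expanding e^((c - c') X) into powers of X = (x - y)^2. *)
Let moments_extend (c c' : R) : 0 < c -> 0 < c' -> c' < 2 * c ->
  (forall k, m k c = 0) -> forall k, m k c' = 0.
Proof.
move=> c0 c'0 cc' mc k.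
pose h x := f x * ((x - y) ^+ 2) ^+ k * expR (- (c * (x - y) ^+ 2)).
pose z x := (c - c') * (x - y) ^+ 2.
have eE X : expR (- (c' * X)) = expR (- (c * X)) * expR ((c - c') * X).
  by rewrite -expRD; congr expR; ring.
have mh : measurable_fun setT h by exact: mint.
have mz : measurable_fun setT z by exact: measurable_funM.
have hz : mu.-integrable setT (EFin \o (fun x => `|h x| * (`|z x| * expR `|z x|))).
  have d0 : 0 < c - `|c - c'| by rewrite subr_gt0 ltr_norml; apply/andP; split; lra.
  have := integrableZR `|c - c'| measurableT (integrable_gaussian_moment k.+1 d0).
  apply: eq_integrable => // x _ /=; congr EFin.
  rewrite /h /z; move: (sqr_ge0 (x - y)); move: ((x - y) ^+ 2) => X X0.
  rewrite !normrM [`|X ^+ k|]ger0_norm ?exprn_ge0// [`|X|]ger0_norm//.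
  rewrite [`|expR (- _)|]ger0_norm ?expR_ge0// exprS.
  have -> : expR (- ((c - `|c - c'|) * X)) = expR (- (c * X)) * expR (`|c - c'| * X).
    by rewrite -expRD; congr expR; ring.
  by ring.
have := @integral_expR_series _ _ R mu h z mh mz hz.
under eq_fun => n.
  under eq_bigr => i _.
    rewrite (_ : \int[mu]_x (h x * z x ^+ i.+1) = 0) ?mul0r; last first.
      rewrite -[RHS](mulr0 ((c - c') ^+ i.+1)) -(mc (k + i.+1)%N) -RintegralZl//.
        apply: eq_Rintegral => x _; rewrite /h /z; move: ((x - y) ^+ 2) => X.
        by rewrite exprMn exprD; ring.
      exact: igauss'.
    over.
  rewrite big1//.
  over.
move=> /(cvg_unique _ (cvg_cst _)) => /(_ (@Rhausdorff R)) /esym.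
under eq_Rintegral do rewrite mulrBr mulr1.
rewrite RintegralB//; last exact: igauss'.
  rewrite (mc k : \int[mu]_x h x = 0) subr0 => hE.
  rewrite -[RHS]hE; apply: eq_Rintegral => x _.
  by rewrite eE /h /z; ring.
have := igauss' k c'0; apply: eq_integrable => // x _; congr EFin.
by rewrite /= eE /h /z; ring.
Qed.

(** Analytic continuation by discs: the power series at c reaches every c' in ]0, 2c[, so each
    centre lambda/2 (3/2)^n is within reach of the previous one, and the centres exceed every
    bound. *)
Lemma gaussian_transform_vanish (c : R) : 0 < c ->
  \int[mu]_x (f x * expR (- (c * (x - y) ^+ 2))) = 0.
Proof.
move=> c0; pose q n : R := lambda / 2 * (3 / 2) ^+ n.
have q0 n : 0 < q n by rewrite mulr_gt0 ?divr_gt0// exprn_gt0// divr_gt0.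
have mq n : forall k, m k (q n) = 0.
  elim: n => [|n ih] k.
    by apply: moments; rewrite /q expr0 mulr1; apply/andP; split; move: lambda0; lra.
  apply: (moments_extend (q0 n) (q0 n.+1)) => //.
  by have := q0 n; rewrite /q exprS; lra.
have bern n : lambda / 2 * (1 + n%:R / 2) <= q n.
  elim: n => [|n ih]; first by rewrite /q !mul0r expr0 addr0.
  have ln : 0 <= lambda * n%:R by rewrite mulr_ge0// ltW.
  have -> : q n.+1 = 3 / 2 * q n by rewrite /q (exprS _ n); ring.
  have -> : lambda / 2 * (1 + n.+1%:R / 2) =
      3 / 2 * (lambda / 2 * (1 + n%:R / 2)) - lambda * n%:R / 8.
    by rewrite -natr1; field.
  by move: ih ln; lra.
have c4 : 0 <= 4 * c / lambda by rewrite divr_ge0 ?mulr_ge0// ltW.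
have := archi_boundP c4.
set n := Num.bound _; rewrite ltr_pdivrMr// => nc.
have cn : c < 2 * q n.
  have := bern n; move: nc lambda0 c0; rewrite mulrDr mulrA.
  by rewrite [lambda / 2 * _ / 2](_ : _ = n%:R * lambda / 4); [lra|field].
have := moments_extend (q0 n) c0 cn (mq n) 0%N; rewrite /m => <-.
by apply: eq_Rintegral => x _; rewrite expr0 mulr1.
Qed.

End gaussian_transform.

(** * From a null-controlled solution to a zero control and a zero initial state *)

Section null_control.
Context {R : realType}.
Notation mu := (@lebesgue_measure R).

Lemma ae_neq (p : R) : {ae mu, forall x, x != p}.
Proof.
exists [set p]; split; [exact: measurable_set1|exact: lebesgue_measure_set1|].
by move=> x /= /negP; rewrite negbK => /eqP.
Qed.

Lemma ae_eq0_gaussian (f : R -> R) (lambda : R) : measurable_fun setT f ->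
  mu.-integrable setT (EFin \o (fun x => f x * (oneDsqr x)^-1)) -> 0 < lambda ->
  (forall y c, 0 < c < lambda ->
    \int[mu]_x (f x * expR (- (c * (x - y) ^+ 2))) = 0) ->
  {ae mu, forall x, f x = 0}.
Proof.
move=> mf fi l0 f0; apply: ae_eq0_balls => // [n|y r r0].
  have iN := integrableZR (1 + n%:R ^+ 2) measurableT (integrable_norm_decay fi).
  have : mu.-integrable `]- n%:R, n%:R[
    (EFin \o (fun x => (1 + n%:R ^+ 2) * (`|f x| * (oneDsqr x)^-1))).
    by apply: integrableS iN.
  apply: le_integrableR => //; first exact: measurable_funTS.
  move=> x; rewrite /= in_itv/= => /andP[nx xn].
  rewrite mulrCA ler_peMr// ler_pdivlMr ?oneDsqr_gt0// mul1r /oneDsqr lerD2l.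
  by rewrite !expr2; nra.
(* The ball is the set a > 1; the summand 1 provides the positive threshold that Phragmen's kernel
   asks for. The moments are Gaussian transforms at integer rates, all zero, so the moment bound is
   0. *)
pose a x := r ^+ 2 + 1 - (x - y) ^+ 2.
have ma : measurable_fun setT a.
  by apply: measurable_funB => //; apply: measurable_funX; exact: measurable_funB.
have -> : [set x | `|x - y| < r] = [set x | 1 < a x].
  apply/seteqP; split => x /=; rewrite /a ltr_norml.
    by move=> /andP[? ?]; rewrite !expr2; nra.
  by rewrite !expr2 => h; apply/andP; split; nra.
have aE n x : expR (n%:R * a x) = expR (n%:R * (r ^+ 2 + 1)) * expR (- (n%:R * (x - y) ^+ 2)).
  by rewrite -expRD; congr expR; rewrite /a; ring.
apply: (@phragmen_mikusinski _ _ R mu f a (r ^+ 2 + 1) 0) => //.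
- by move=> x; rewrite gerBl sqr_ge0.
- have := integrableZR (expR (r ^+ 2 + 1)) measurableT
    (integrable_gaussian_moment y mf fi 0 ltr01).
  apply: eq_integrable => // x _ /=; congr EFin.
  by have := aE 1%N x; rewrite !mul1r => ->; rewrite expr0 mulr1 mulrCA.
- move=> n; have n0 : 0 < n.+1%:R :> R by rewrite ltr0n.
  under eq_Rintegral do rewrite aE mulrCA.
  rewrite RintegralZl//; last exact: integrable_gaussian.
  by rewrite (gaussian_transform_vanish mf fi l0 (f0 y) n0) mulr0 normr0.
- have := ae_neq (y + r); have := ae_neq (y - r).
  apply: filterS2; first exact: (ae_filter_ringOfSetsType mu).
  move=> x /eqP x1 /eqP x2; apply/eqP; rewrite /a => xE.
  have : (x - y - r) * (x - y + r) = 0 by move: xE; rewrite !expr2; nra.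
  by move=> /eqP; rewrite mulf_eq0 => /orP[] /eqP h; [apply: x2|apply: x1]; lra.
Qed.

Section vanishing.
Variables (T : R) (w : R -> R -> R) (u : R -> R).
Hypotheses (T0 : 0 < T) (wP : controlled_heat T w u).
Hypothesis wT : {ae mu, forall x, w T x = 0}.

Let w0P : measurable_fun setT (w 0) /\
  mu.-integrable setT (EFin \o (fun x => w 0 x * (oneDsqr x)^-1)).
Proof. by have [+ _ _ _] := wP; apply; rewrite lexx ltW. Qed.

Let null_duality (C : R) (Phi : nat -> R -> R -> R) : 0 < C ->
  backward_heat_jet T C Phi ->
  \int[mu]_x (w 0 x * Phi 0%N 0 x) = - \int[mu]_(s in `[0, T]) (2 * u s * Phi 1%N s 0).
Proof.
move=> C0 J; rewrite -(duality_pairing T0 wP C0 J).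
have TT : 0 <= T <= T by rewrite lexx ltW.
suff -> : \int[mu]_x (w T x * Phi 0%N T x) = 0 by rewrite sub0r opprK.
have [/(_ T TT)[mwT _] _ _ _] := wP; have [dP _ _ _] := J.
rewrite (@ae_eq_Rintegral _ _ _ mu setT _ (cst 0))//.
- by rewrite /Rintegral integral0.
- apply: measurable_funM => //; apply: continuous_measurable_fun.
  by apply: derivable_continuous => x; have [] := dP 0%N T x TT.
- apply: filterS wT; first exact: (ae_filter_ringOfSetsType mu).
  by move=> x wTx _; rewrite wTx mul0r.
Qed.

Let tau : R := T + 1.
Let v := inv_sqrt_time tau.

Let Ttau : T < tau. Proof. by rewrite ltrDl. Qed.

Let v_gt0 s : s <= T -> 0 < v s.
Proof. by move=> sT; apply: inv_sqrt_time_gt0; exact: le_lt_trans Ttau. Qed.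

Let mv : measurable_fun `[0, T] v.
Proof.
apply: subspace_continuous_measurable_fun => //.
apply: derivable_within_continuous => q; rewrite in_itv/= => /andP[_ qT].
by have [] := @is_derive_inv_sqrt_time _ tau q (le_lt_trans qT Ttau).
Qed.

Let vsqr s : s <= T -> v s ^+ 2 = (tau - s)^-1.
Proof.
move=> sT; rewrite /v /inv_sqrt_time exprVn sqr_sqrtr// subr_ge0.
exact: le_trans (ltW Ttau).
Qed.

Let v00 : 0 < v 0. Proof. by apply: v_gt0; exact: ltW. Qed.

Let integrable_exponential (n : nat) : mu.-integrable `[0, T]
  (EFin \o (fun s => u s * v s ^+ 3 * expR (n%:R * (v s ^+ 2 - v 0 ^+ 2)))).
Proof.
have [_ [mu_ [U uU]] _ _] := wP.
apply: (@le_integrableR _ _ _ _ _ _ (cst (U * v T ^+ 3 * expR (n%:R * v T ^+ 2)))) => //.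
- apply: measurable_funM.
    apply: measurable_funM; first exact: measurable_funTS.
    exact: measurable_funX.
  apply: measurableT_comp => //; apply: measurable_funM => //.
  by apply: measurable_funB => //; exact: measurable_funX.
- move=> s; rewrite /= in_itv/= => /andP[s0 sT].
  have vs := v_gt0 sT; have vsT : v s <= v T by exact: le_inv_sqrt_time.
  rewrite normrM (ger0_norm (expR_ge0 _)) (normrM (u s)) normrX (gtr0_norm vs).
  apply: ler_pM; rewrite ?mulr_ge0 ?exprn_ge0 ?expR_ge0 ?(ltW vs)//.
    apply: ler_pM => //; first by rewrite exprn_ge0// ltW.
    by rewrite lerXn2r// nnegrE ltW// v_gt0.
  rewrite ler_expR ler_wpM2l// lerBlDr ler_wpDr ?sqr_ge0//.
  by rewrite lerXn2r// nnegrE ltW// v_gt0.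
- apply: continuous_compact_integrable; first exact: segment_compact.
  by apply: continuous_subspaceT => x; exact: cvg_cst.
Qed.

(** The sine packet with sigma^2/4 = n + 1 gives the slope sigma/2 v^3 e^((n+1) v^2) at the origin,
    while at time 0 it is at most v(0) e^((n+1) v(0)^2) times a Gaussian independent of n. Dividing
    the duality identity by e^((n+1) v(0)^2) bounds sigma times the moment by v(0) A, and sigma >=
    1. *)
Let exponential_moment_bound : exists A : R, forall n : nat,
  `|\int[mu]_(s in `[0, T]) (u s * v s ^+ 3 *
     expR (n.+1%:R * (v s ^+ 2 - v 0 ^+ 2)))| <= A.
Proof.
have [mw iw] := w0P; have [_ [mu_ [U uU]] _ _] := wP.
have c0 : 0 < v 0 ^+ 2 / 4 by rewrite divr_gt0// exprn_gt0.
pose A := \int[mu]_x (`|w 0 x| * ((x - 0) ^+ 2) ^+ 0 * expR (- (v 0 ^+ 2 / 4 * (x - 0) ^+ 2))).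
exists (v 0 * A) => n.
pose sg : R := 2 * Num.sqrt n.+1%:R.
have n0 : 0 < n.+1%:R :> R by rewrite ltr0n.
have sg2 : sg ^+ 2 = 4 * n.+1%:R.
  by rewrite /sg exprMn sqr_sqrtr ?ltW// -natrX.
have sg1 : 1 <= sg.
  have s0 : 0 <= Num.sqrt (n.+1%:R : R) by exact: sqrtr_ge0.
  have : 1 <= Num.sqrt (n.+1%:R : R) by rewrite -[leLHS]sqrtr1 ler_wsqrtr// ler1n.
  by rewrite /sg; lra.
have [C [Phi [C0 J Phi0 Phi1]]] := sin_packet_jet sg 0 (ltW T0) Ttau.
have Phi1E s : Phi 1%N s 0 = sg / 2 * v s ^+ 3 * expR (n.+1%:R * v s ^+ 2).
  rewrite Phi1 /cos_packet !subr0 mulr0 !mul0r cos0 expr0n/= subr0 sg2 -/v.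
  rewrite (_ : 4 * n.+1%:R * v s ^+ 2 / 4 = n.+1%:R * v s ^+ 2); last by field.
  by field.
have Phi0E x : `|Phi 0%N 0 x| <= v 0 * expR (n.+1%:R * v 0 ^+ 2) *
    expR (- (v 0 ^+ 2 / 4 * (x - 0) ^+ 2)).
  rewrite Phi0 /sin_packet -/v normrM gtr0_norm// -[leRHS]mulrA ler_wpM2l ?(ltW v00)//.
  rewrite normrM ger0_norm ?expR_ge0// -expRD.
  rewrite (_ : (sg ^+ 2 - (x - 0) ^+ 2) * v 0 ^+ 2 / 4 =
    n.+1%:R * v 0 ^+ 2 - v 0 ^+ 2 / 4 * (x - 0) ^+ 2); last by rewrite sg2; field.
  by rewrite ler_piMr ?expR_ge0// ler_norml sin_geN1 sin_le1.
have [dP _ _ mP] := J.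
have T00 : 0 <= (0 : R) <= T by rewrite lexx (ltW T0).
have up : `|\int[mu]_x (w 0 x * Phi 0%N 0 x)| <= v 0 * expR (n.+1%:R * v 0 ^+ 2) * A.
  have ig := integrable_gaussian_moment 0 mw iw 0 c0.
  rewrite /A -RintegralZl//; apply: le_norm_Rintegral => //.
  - apply: measurable_funM => //; apply: continuous_measurable_fun.
    by apply: derivable_continuous => x; have [] := dP 0%N 0 x T00.
  - exact: integrableZR.
  - move=> x _; rewrite normrM expr0 mulr1 [leRHS]mulrCA ler_wpM2l//; exact: Phi0E.
have uE : \int[mu]_(s in `[0, T]) (2 * u s * Phi 1%N s 0) =
    sg * expR (n.+1%:R * v 0 ^+ 2) * \int[mu]_(s in `[0, T]) (u s * v s ^+ 3 *
      expR (n.+1%:R * (v s ^+ 2 - v 0 ^+ 2))).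
  rewrite -RintegralZl//.
    apply: eq_Rintegral => s _; rewrite Phi1E.
    have -> : expR (n.+1%:R * v s ^+ 2) = expR (n.+1%:R * v 0 ^+ 2) *
        expR (n.+1%:R * (v s ^+ 2 - v 0 ^+ 2)) by rewrite -expRD; congr expR; ring.
    by field.
move: up; rewrite (null_duality C0 J) normrN uE normrM gtr0_norm; last first.
  by rewrite mulr_gt0 ?expR_gt0// (lt_le_trans _ sg1).
set I := `| _ | => up.
have e0 := expR_gt0 (n.+1%:R * v 0 ^+ 2).
have A0 : 0 <= v 0 * A.
  rewrite mulr_ge0 ?(ltW v00)// Rintegral_ge0// => x _.
  by rewrite expr0 mulr1 mulr_ge0 ?expR_ge0.
have I0 : 0 <= I by exact: normr_ge0.
have : sg * I <= v 0 * A.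
  by rewrite -(ler_pM2l e0) [leLHS]mulrCA [leRHS]mulrCA [leLHS]mulrA [leRHS]mulrA.
by apply: le_trans; rewrite ler_peMl.
Qed.

(** The exponent v(s)^2 - v(0)^2 increases strictly from 0 on [0, T] and is extended by 0, so its
    superlevel set at the threshold taken at t is ]t, T]. Hence all tail integrals of [h] vanish,
    and its primitive on ]0, T[ is constantly the total integral. *)
Lemma null_control_vanish : {ae mu, forall s, 0 < s < T -> u s = 0}.
Proof.
have [A hA] := exponential_moment_bound; have [_ [mu_ [U uU]] _ _] := wP.
pose h := (fun s => u s * v s ^+ 3) \_ `[0, T].
pose a := (fun s => v s ^+ 2 - v 0 ^+ 2) \_ `[0, T].
have mh : measurable_fun setT h.
  apply/(measurable_restrictT _ _).1 => //; apply: measurable_funM; first exact: measurable_funTS.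
  exact: measurable_funX.
have ma : measurable_fun setT a.
  apply/(measurable_restrictT _ _).1 => //; apply: measurable_funB => //.
  exact: measurable_funX.
have v2 s t : s <= t -> t <= T -> v s ^+ 2 <= v t ^+ 2.
  move=> st tT; have sT := le_trans st tT.
  rewrite lerXn2r ?nnegrE ?(ltW (v_gt0 _))//.
  by apply: le_inv_sqrt_time => //; exact: le_lt_trans Ttau.
have aA s : a s <= v T ^+ 2.
  rewrite /a patchE; case: ifPn => [|_]; last exact: sqr_ge0.
  rewrite inE/= in_itv/= => /andP[s0 sT]; have := v2 _ _ sT (lexx _).
  by have := sqr_ge0 (v 0); lra.
have hi : mu.-integrable setT (EFin \o (fun x => `|h x| * expR (a x))).
  have : mu.-integrable setT (EFin \o ((fun s =>
      `|u s * v s ^+ 3 * expR (1%:R * (v s ^+ 2 - v 0 ^+ 2))|) \_ `[0, T])).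
    by apply: integrable_patch => //; exact: integrable_norm (integrable_exponential 1).
  apply: eq_integrable => // s _ /=; congr EFin.
  rewrite /h /a !patchE; case: ifPn => _; last by rewrite normr0 mul0r.
  by rewrite /= mul1r normrM (ger0_norm (expR_ge0 _)).
have hI : mu.-integrable setT (EFin \o h).
  apply: integrable_patch => //; have := integrable_exponential 0.
  by apply: eq_integrable => // s _ /=; rewrite mul0r expR0 mulr1.
have zero t : 0 < t < T -> \int[mu]_(s in [set s | v t ^+ 2 - v 0 ^+ 2 < a s]) h s = 0.
  move=> /andP[t0 tT].
  have vt : 0 < v t ^+ 2 - v 0 ^+ 2.
    rewrite subr_gt0 !vsqr ?ltW// ltf_pV2 ?posrE ?subr_gt0//.
    - by rewrite ltrD2l ltrN2.
    - exact: lt_trans Ttau.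
    - exact: lt_trans Ttau.
  apply: (@phragmen_mikusinski _ _ R mu h a (v T ^+ 2) A) => //.
    move=> n; have := hA n; rewrite [X in `|X| <= _ -> _]Rintegral_mkcond.
    congr (`| _ | <= _); apply: eq_Rintegral => s _.
    by rewrite /h /a !patchE; case: ifPn => //; rewrite mul0r.
  apply: filterS (ae_neq t); first exact: (ae_filter_ringOfSetsType mu).
  move=> s st; rewrite /a patchE; case: ifPn => [|_]; last by rewrite lt_eqF.
  rewrite inE/= in_itv/= => /andP[s0 sT].
  rewrite (inj_eq (addIr _)) !vsqr ?(ltW tT)//.
  rewrite (inj_eq (@invr_inj _)) (inj_eq (addrI _)) (inj_eq (@oppr_inj _)).
  exact: st.
have hU : {ae mu, forall s, `]0, T[%classic s -> h s = 0}.
  apply: (@ae_eq0_primitive _ h _ (\int[mu]_s h s)) => //.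
  move=> x; rewrite /= in_itv/= => /andP[x0 xT].
  have hI' : mu.-integrable `]-oo, +oo[ (EFin \o h) by rewrite set_itvNyy.
  have := Rintegral_itvB hI' (x := x); rewrite set_itvNyy.
  move=> /(_ isT isT) /eqP; rewrite subr_eq => /eqP ->.
  rewrite -[LHS]add0r; congr (_ + _); apply/esym.
  rewrite -[RHS](zero x) ?x0//.
  rewrite Rintegral_mkcond [RHS]Rintegral_mkcond; apply: eq_Rintegral => s _.
  have [sT|sT] := boolP (s \in `[0, T]); last first.
    have hs : h s = 0 by rewrite /h patchE memNset//=; exact/negP.
    by rewrite !patchE hs !if_same.
  have aE : a s = v s ^+ 2 - v 0 ^+ 2 by rewrite /a patchE mem_set.
  move: sT; rewrite in_itv/= => /andP[s0 sT].
  rewrite !patchE; congr (if _ then _ else _).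
  apply/idP/idP; rewrite !inE/= in_itv/= andbT aE ltrD2r.
    move=> xs; rewrite !vsqr ?(ltW xT)// ltf_pV2 ?posrE ?subr_gt0 ?(le_lt_trans _ Ttau)//.
      by rewrite ltrD2l ltrN2.
    exact: ltW.
  by apply: contraTT; rewrite -!leNgt => sx; apply: v2 => //; exact: ltW.
apply: filterS hU; first exact: (ae_filter_ringOfSetsType mu).
move=> s hs /andP[s0 sT].
have : h s = 0 by apply: hs; rewrite /= in_itv/= s0.
rewrite /h patchE mem_set/=; last by rewrite in_itv/= !ltW.
by move=> /eqP; rewrite mulf_eq0 expf_eq0/= (gt_eqF (v_gt0 (ltW sT))) orbF => /eqP.
Qed.

(** With sigma = 0 the cosine packet is a real heat kernel centred at y. Taking tau' = 1/(4c) makes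
    its profile at time 0 a multiple of e^(-c (x - y)^2), and tau' > T amounts to c < 1/(4T), the
    range from which the Gaussian transform is continued. *)
Lemma null_controllable_vanish : {ae mu, forall x, w 0 x = 0}.
Proof.
have [mw iw] := w0P.
have l0 : 0 < (4 * T)^-1 by rewrite invr_gt0 mulr_gt0.
apply: (ae_eq0_gaussian mw iw l0) => y c /andP[c0 cT].
pose tau' := (4 * c)^-1.
have tau'0 : 0 < tau' by rewrite invr_gt0 mulr_gt0.
have Tt : T < tau'.
  rewrite /tau' -[T]invrK ltf_pV2 ?posrE ?invr_gt0 ?mulr_gt0//.
  by move: cT; rewrite invfM; lra.
have [C [Phi [C0 J Phi0]]] := cos_packet_jet 0 y (ltW T0) Tt.
have v0 : 0 < inv_sqrt_time tau' 0 by apply: inv_sqrt_time_gt0.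
have v02 : inv_sqrt_time tau' 0 ^+ 2 = 4 * c.
  by rewrite /inv_sqrt_time subr0 exprVn sqr_sqrtr ?(ltW tau'0)// invrK.
have PhiE x : Phi 0%N 0 x = inv_sqrt_time tau' 0 * expR (- (c * (x - y) ^+ 2)).
  rewrite Phi0 /cos_packet v02 !mul0r cos0 mulr1; congr (_ * expR _).
  by rewrite expr2 mul0r; field.
have := null_duality C0 J; under eq_Rintegral do rewrite PhiE mulrCA.
rewrite RintegralZl//; last exact: integrable_gaussian.
have [_ [mu_ _] _ _] := wP; have [_ _ _ mP] := J.
have -> : \int[mu]_(s in `[0, T]) (2 * u s * Phi 1%N s 0) = 0.
  rewrite (@ae_eq_Rintegral _ _ _ mu `[0, T] _ (cst 0))//.
  - by rewrite /Rintegral integral0.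
  - apply: measurable_funM => //; apply: measurable_funM => //.
    exact: measurable_funTS.
  have := null_control_vanish; have := ae_neq 0; have := ae_neq T.
  apply: filterS3; first exact: (ae_filter_ringOfSetsType mu).
  move=> s sT s0 us0; rewrite /= in_itv/= => /andP[s0' sT'].
  by rewrite us0 ?mulr0 ?mul0r// !lt_neqAle eq_sym s0 s0' sT.
by rewrite oppr0 => /eqP; rewrite mulf_eq0 gt_eqF//= => /eqP.
Qed.

End vanishing.

End null_control.

(** * Real and imaginary parts of a solution *)

Section scalar_parts.
Context {R : realType}.
Notation mu := (@lebesgue_measure R).
Implicit Types (K : scalar_field) (z : R[i]) (f g : R -> R[i]).

Definition part (b : bool) z : R := if b then complex.Re z else complex.Im z.

Lemma partD b z1 z2 : part b (z1 + z2) = part b z1 + part b z2.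
Proof. by case: b z1 z2 => -[? ?] [? ?]. Qed.

Lemma partM b z (r : R) : part b (z * r%:C) = part b z * r.
Proof. by case: b z => -[x y] /=; rewrite !mulr0 ?subr0 ?add0r. Qed.

Lemma part_cintegral b D f : part b (cintegral D f) = \int[mu]_(x in D) part b (f x).
Proof. by case: b. Qed.

Lemma part_cintegrable b D f : cintegrable D f ->
  mu.-integrable D (EFin \o (fun x => part b (f x))).
Proof. by case: b => -[]. Qed.

Lemma part_cmeasurable b D f : cmeasurable D f ->
  measurable_fun D (fun x => part b (f x)).
Proof. by case: b => -[]. Qed.

Lemma normcE z : Normc.normc z = Num.sqrt (complex.Re z ^+ 2 + complex.Im z ^+ 2).
Proof. by case: z. Qed.

Lemma normc_real (r : R) : Normc.normc r%:C = `|r|.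
Proof. by rewrite normcE/= expr0n addr0 sqrtr_sqr. Qed.

Lemma norm_part b z : `|part b z| <= Normc.normc z.
Proof.
rewrite normcE -sqrtr_sqr; apply: ler_wsqrtr.
by case: b; rewrite /= ?lerDl ?lerDr sqr_ge0.
Qed.

Lemma measurable_normc D f : cmeasurable D f ->
  measurable_fun D (fun x => Normc.normc (f x)).
Proof.
move=> [m1 m2]; under eq_fun do rewrite normcE.
have msq : measurable_fun setT (Num.sqrt : R -> R).
  by apply: continuous_measurable_fun; exact: sqrt_continuous.
apply: (measurableT_comp msq).
by apply: measurable_funD; exact: measurable_funX.
Qed.

Lemma integral_normc_sqr f :
  (cLnorm 2%:E setT f < +oo)%E <->
  (\int[mu]_x (Normc.normc (f x) ^+ 2)%:E < +oo)%E.
Proof.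
have E : (\int[mu]_x `|(EFin \o ((fun x => Normc.normc (f x)) \_ setT)) x| `^ 2 =
    \int[mu]_x (Normc.normc (f x) ^+ 2)%:E)%E.
  apply: eq_integral => x _; rewrite /= patch_setT powR_mulrn//.
  by rewrite real_normK// num_real.
rewrite -E /cLnorm; split => h.
  by rewrite -powR_Lnorm//; exact: poweR_lty.
by rewrite unlock; exact: poweR_lty.
Qed.

(** Young's inequality: with a weight q in [0, 1], |f| q <= |f|^2 + q^2 <= |f|^2 + q. *)
Lemma integrable_decay_L2 K b f : L2 K f ->
  mu.-integrable setT (EFin \o (fun x => part b (f x) * (oneDsqr x)^-1)).
Proof.
move=> [_ mf /integral_normc_sqr fi].
have i2 : mu.-integrable setT (EFin \o (fun x => Normc.normc (f x) ^+ 2)).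
  apply/integrableP; split.
    by apply/measurable_EFinP; apply: measurable_funX; exact: measurable_normc.
  by under eq_integral do rewrite /= ger0_norm ?sqr_ge0//.
have := integrableDR measurableT i2 integrable_inv_oneDsqr.
apply: le_integrableR => //.
  apply: measurable_funM; first exact: part_cmeasurable.
  by apply: continuous_measurable_fun; exact: continuous_oneDsqrV.
move=> x _; rewrite normrM (ger0_norm (oneDsqrV_ge0 _)).
have := norm_part b (f x); have := oneDsqrV_le1 x; have := oneDsqrV_ge0 x.
rewrite /=; move: (_^-1) (Normc.normc _) => q n q0 q1 pn.
have p0 := normr_ge0 (part b (f x)).
by rewrite expr2; nra.
Qed.

Lemma in_scalars_real K (r : R) : in_scalars K r%:C.
Proof. by case: K. Qed.

Lemma cmeasurable_real D (h : R -> R) : measurable_fun D h ->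
  cmeasurable D (fun x => (h x)%:C).
Proof. by move=> mh; split => //=; exact: measurable_cst. Qed.

Lemma cintegral_real (h : R -> R) :
  cintegral setT (fun x => (h x)%:C) = (\int[mu]_x h x)%:C.
Proof. by rewrite /cintegral/= Rintegral_cst// mul0r. Qed.

Lemma L2_decay K (h : R -> R) (C : R) : measurable_fun setT h ->
  (forall x, `|h x| <= C * (oneDsqr x)^-1) -> L2 K (fun x => (h x)%:C).
Proof.
move=> mh hC; split.
- by move=> x _; exact: in_scalars_real.
- exact: cmeasurable_real.
- apply/integral_normc_sqr.
  have : mu.-integrable setT (EFin \o (fun x => h x ^+ 2)).
    have := integrableZR (C ^+ 2) measurableT integrable_inv_oneDsqr.
    apply: le_integrableR => //; first exact: measurable_funX.
    move=> x _; rewrite ger0_norm ?sqr_ge0// -real_normK ?num_real//.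
    apply: (@le_trans _ _ ((C * (oneDsqr x)^-1) ^+ 2)).
      by rewrite lerXn2r ?nnegrE// (le_trans (normr_ge0 (h x))).
    rewrite exprMn ler_wpM2l ?sqr_ge0// expr2 ler_piMl ?oneDsqrV_ge0//.
    exact: oneDsqrV_le1.
  have E2 x : Normc.normc (h x)%:C ^+ 2 = h x ^+ 2.
    by rewrite normc_real real_normK// num_real.
  under eq_fun do rewrite -E2.
  move=> /integrableP[_]; congr (_ < _)%E; apply: eq_integral => x _ /=.
  by rewrite ger0_norm// sqr_ge0.
Qed.

Lemma weak_derivative_real (k : nat) (h l : R -> R) :
  (forall psi, test_function psi -> \int[mu]_x (h x * derive1n k psi x) =
    (- 1) ^+ k * \int[mu]_x (l x * psi x)) ->
  weak_derivative k (fun x => (h x)%:C) (fun x => (l x)%:C).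
Proof.
move=> hl psi tpsi.
have E (a c : R -> R) : cintegral setT (fun x => (a x)%:C * (c x)%:C) =
    (\int[mu]_x (a x * c x))%:C.
  rewrite -cintegral_real; congr cintegral; apply/funext => x.
  by rewrite -rmorphM.
by rewrite !E hl// rmorphM rmorphXn rmorphN1.
Qed.

(** The jets are real-valued, hence admissible over both scalar fields; this lets one argument serve
    the real and the complex case. *)
Lemma sobolev_h2_ball K (C : R) (F : nat -> R -> R) (i m : nat) : h2_ball C F ->
  (i + m <= 2)%N -> sobolev K m (fun x => (F i x)%:C).
Proof.
move=> [hF dF] im.
have LF j : (j <= 2)%N -> L2 K (fun x => (F j x)%:C).
  by move=> j2; have [mF bF] := hF j j2; exact: L2_decay bF.
split; first by apply: LF; exact: leq_trans (leq_addr _ _) im.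
move=> k km; exists (fun x => (F (i + k)%N x)%:C).
  by apply: LF; apply: leq_trans im; rewrite leq_add2l.
have ik : (i + k <= 2)%N by apply: leq_trans im; rewrite leq_add2l.
apply: weak_derivative_real => psi tpsi.
elim: k {km} psi ik tpsi => [|k ih] psi ik tpsi; first by rewrite addn0 expr0 mul1r.
rewrite -derive1n_shift ih; [|by rewrite ltnW// -addnS|exact: test_function_derive].
by rewrite dF -?addnS// exprS mulN1r mulrN mulNr.
Qed.

End scalar_parts.

Section null_controllability.
Context {R : realType}.
Notation mu := (@lebesgue_measure R).
Implicit Types (K : scalar_field) (f g : R -> R[i]).

Lemma Linfty_ae_bound K (T : R) f : Linfty K T f ->
  exists U : R, {ae mu, forall s, 0 < s < T -> Normc.normc (f s) <= U}.
Proof.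
move=> [_ _]; rewrite /cLnorm unlock/=.
(* The norm at infinity unfolds to an essential supremum once the whole line is known to have
   positive measure. *)
have muT : (0 < mu [set: R])%E by rewrite -set_itvNyy lebesgue_measure_itv/= ltry.
rewrite muT; set g := EFin \o _ => sup_lty.
exists `|fine (ess_sup mu (abse \o g))|.
have := ess_sup_ge mu (abse \o g).
apply: filterS => s gs sT; have gE : (abse \o g) s = (Normc.normc (f s))%:E.
  rewrite /g /= patchE mem_set /=; last by rewrite in_itv.
  by rewrite ger0_norm// (le_trans _ (norm_part true (f s))).
move: sup_lty gs; rewrite gE; case: (ess_sup _ _) => [r _|//|_].
  rewrite lee_fin => /le_trans; apply; exact: ler_norm.
by rewrite leeNy_eq.
Qed.

Lemma cintegral_normr_le b (T t : R) (d : R -> R[i]) : 0 <= t <= T ->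
  cintegrable `[0, T] d -> `|part b (cintegral `[0, t] d)| <=
  \int[mu]_(s in `[0, T]) `|part b (d s)|.
Proof.
move=> /andP[t0 tT] /(part_cintegrable b) di; rewrite part_cintegral.
have sub : `[0, t] `<=` `[0, T]%classic by apply: subset_itvl; rewrite bnd_simp.
have di' : mu.-integrable `[0, t] (EFin \o (fun s => part b (d s))).
  by apply: integrableS di.
apply: le_trans (le_normr_Rintegral _ di') _ => //.
rewrite Rintegral_mkcond [leRHS]Rintegral_mkcond; apply: le_Rintegral => //.
- by apply: integrable_patch => //; exact: integrable_norm di'.
- by apply: integrable_patch => //; exact: integrable_norm di.
move=> s _; rewrite !patchE; case: ifPn => [/set_mem/sub/mem_set -> //|_].
by case: ifPn => _; [exact: normr_ge0|exact: lexx].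
Qed.

Lemma second_derivative_apply K f L (C : R) (F : nat -> R -> R) : h2_ball C F ->
  second_derivative K f L ->
  L (fun x => (F 0%N x)%:C) = functional_of f (fun x => (F 2%N x)%:C).
Proof.
move=> hF [L1 [_ _ dL1] [_ _ dL]].
have s0 := @sobolev_h2_ball _ K C F 0 2 hF isT.
have s1 := @sobolev_h2_ball _ K C F 1 1 hF isT.
have s2 := @sobolev_h2_ball _ K C F 2 0 hF isT.
have w01 : weak_derivative 1 (fun x => (F 0%N x)%:C) (fun x => (F 1%N x)%:C).
  apply: weak_derivative_real => psi tpsi.
  by rewrite (hF.2 0%N)// expr1 mulN1r.
have w12 : weak_derivative 1 (fun x => (F 1%N x)%:C) (fun x => (F 2%N x)%:C).
  apply: weak_derivative_real => psi tpsi.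
  by rewrite (hF.2 1%N)// expr1 mulN1r.
by rewrite (dL _ _ s0 s1.1 w01) (dL1 _ _ s1 s2.1 w12) opprK.
Qed.

Lemma dirac_derivative_apply K L (C : R) (F : nat -> R -> R) : h2_ball C F ->
  continuous (F 1%N) -> dirac_derivative K L ->
  L (fun x => (F 0%N x)%:C) = - (F 1%N 0)%:C.
Proof.
move=> hF cF [L0 [_ dL0] [_ _ dL]].
have s0 := @sobolev_h2_ball _ K C F 0 2 hF isT.
have s1 := @sobolev_h2_ball _ K C F 1 1 hF isT.
have w01 : weak_derivative 1 (fun x => (F 0%N x)%:C) (fun x => (F 1%N x)%:C).
  apply: weak_derivative_real => psi tpsi.
  by rewrite (hF.2 0%N)// expr1 mulN1r.
rewrite (dL _ _ s0 s1.1 w01) dL0//.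
by split=> //= x; exact: cvg_cst.
Qed.

(** The equation has real coefficients, so the real and imaginary parts decouple. For a fixed jet,
    the bound over all times comes from the integrability of the time derivative of the pairing. *)
Lemma solution_controlled_heat K (T : R) W0 u W b : 0 < T -> Linfty K T u ->
  solution K T W0 u W ->
  exists v, controlled_heat T (fun t x => part b (W t x)) v.
Proof.
move=> T0 uLy [WL2 _ [dW [_ dWt dWeq]]].
have [U uU] := Linfty_ae_bound uLy.
have [_ mu_ _] := uLy.
(* The control is bounded only almost everywhere; truncating at the level |U| gives one that is
   bounded everywhere and agrees with it almost everywhere on ]0, T[. *)
pose pu := (fun s => part b (u s)) \_ `]0, T[.
pose v s := Num.max (- `|U|) (Num.min `|U| (pu s)).
have mpu : measurable_fun setT pu.
  by apply/(measurable_restrictT _ _).1 => //; exact: part_cmeasurable.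
have vE : {ae mu, forall s, 0 < s < T -> v s = part b (u s)}.
  apply: filterS uU; first exact: (ae_filter_ringOfSetsType mu).
  move=> s us sT; have := le_trans (norm_part b (u s)) (us sT).
  rewrite /v /pu patchE mem_set/= ?in_itv// => /le_trans/(_ (ler_norm _)).
  by rewrite ler_norml => /andP[uN uP]; rewrite min_r// max_r.
have pairE t (F : R -> R) : part b (functional_of (W t) (fun x => (F x)%:C)) =
    \int[mu]_x (part b (W t x) * F x).
  by rewrite part_cintegral; apply: eq_Rintegral => x _; rewrite partM.
have T00 : 0 <= (0 : R) <= T by rewrite lexx (ltW T0).
exists v; split.
- move=> t tT; have [L2W _] := WL2 t tT; split; last exact: integrable_decay_L2 L2W.
  by apply: part_cmeasurable; case: L2W.
- split.
    by apply: measurable_maxr => //; apply: measurable_minr.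
  exists `|U| => s; rewrite ler_norml /v le_max lexx/= ge_max ge_min lexx/= andbT.
  by rewrite -subr_ge0 opprK addr_ge0.
- move=> C F hF; have s0 := @sobolev_h2_ball _ K C F 0 2 hF isT.
  have [di dE] := dWt _ s0.
  exists (`|\int[mu]_x (part b (W 0 x) * F 0%N x)| +
    \int[mu]_(s in `[0, T]) `|part b (dW s (fun x => (F 0%N x)%:C))|) => t tT.
  rewrite -!pairE dE// partD; apply: le_trans (ler_normD _ _) _; rewrite lerD2l.
  exact: cintegral_normr_le.
- move=> C F hF cF; have s0 := @sobolev_h2_ball _ K C F 0 2 hF isT.
  have [di dE] := dWt _ s0.
  exists (fun s => part b (dW s (fun x => (F 0%N x)%:C))); split.
  + exact: part_cintegrable.
  + have := dWeq; have := vE.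
    apply: filterS2; first exact: (ae_filter_ringOfSetsType mu).
    move=> s vs eqs sT; have [Wxx [delta' [hWxx hd eqW]]] := eqs sT.
    rewrite eqW// (second_derivative_apply hF hWxx) (dirac_derivative_apply hF cF hd).
    (* The derivative of the Dirac distribution contributes - F'(0), which turns the control term
       into + 2 u F'(0). *)
    rewrite mulrN opprK partD pairE partM vs//.
    by congr (_ + _ * _); rewrite mulr_natl mulr2n partD; ring.
  + by move=> t tT; rewrite -!pairE dE// partD part_cintegral.
Qed.

End null_controllability.

Theorem theorem6p2 (R : realType) (K : scalar_field) (T : R) (W0 : R -> R[i])
  (hT : 0 < T) (hW0 : odd_L2 K W0) (hnull : null_controllable K T W0) :
  eq_ae W0 (cst 0).
Proof.
have [_ [u uLy [W [Wsol _] WT]]] := hnull.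
have W0E b : {ae lebesgue_measure, forall x, part b (W 0 x) = 0}.
  have [v wP] := solution_controlled_heat b hT uLy Wsol.
  apply: null_controllable_vanish hT wP _.
  apply: filterS WT; first exact: (ae_filter_ringOfSetsType lebesgue_measure).
  by move=> x /= ->; case: b.
have [_ WW0 _] := Wsol.
have := W0E true; have := W0E false; have := WW0.
apply: filterS3; first exact: (ae_filter_ringOfSetsType lebesgue_measure).
by move=> x <- /=; case: (W 0 x) => a c /= -> ->.
Qed.
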